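(* Let $K$ be a field, $c\ge 1$ an integer, and $\mathbf{P} = (\mathbf{X}^{\mathrm{OI},1})^{\otimes c}$. Let $\mathbf{M}$ be a monomial submodule of the free $\mathrm{OI}$-module $\mathbf{F} = \mathbf{F}^{\mathrm{OI},d}$ over $\mathbf{P}$, where $d\ge 0$. Assume that the width of any monomial minimal generator of $\mathbf{M}$ is at most $m$. Set $\mathbf{G} = \mathbf{F}^{\mathrm{OI},d-1}$ if $d \ge 1$ and $\mathbf{G} = 0$ if $d = 0$. Consider any $e = (e_1,\ldots,e_c) \in \mathbb{N}_0^c$. There are monomial submodules $\mathbf{Q}'$ of $\mathbf{G}$ and $\mathbf{Q}''$ of $\mathbf{F}$ generated in width $m-1$ and $m$, respectively, with $\mathbf{Q}''_{m-1} = 0$ and the following two properties: (a) For every integer $n \ge m+1$, there are isomorphisms of graded $\mathbf{P}_{n-1}$-modules \[ \mathbf{F}_n/(\mathbf{M}_n : x_{\cdot, 1}^e + \mathbf{x}_1 \mathbf{F}_n) \cong \mathbf{G}_{n-1}/\mathbf{Q}'_{n-1} \oplus \mathbf{F}_{n-1}/\mathbf{Q}''_{n-1}. \] (b) \[ \sum_{k=0}^{e^+ (\mathbf{M}_m)} \dim_K [\mathbf{F}_m/\mathbf{M}_m ]_k \ge \sum_{k=0}^{e^+ (\mathbf{Q}''_m)} \dim_K [\mathbf{F}_m/\mathbf{Q}''_m]_k, \] and equality is true if and only if $\mathbf{M}_n = \mathbf{Q}''_n$ for every $n \ge m$.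
   Context: $\mathrm{OI}$ is the category with objects $[n] = \{1,\dots,n\}$, $n \ge 0$ ($[0]=\emptyset$), and morphisms the strictly increasing maps $\varepsilon\colon [m]\to[n]$. $\mathbf{P} = (\mathbf{X}^{\mathrm{OI},1})^{\otimes c}$ is the functor from $\mathrm{OI}$ to commutative $K$-algebras with $\mathbf{P}_n = K[x_{i,j} : 1\le i\le c,\ 1\le j\le n]$ (so $\mathbf{P}_0=K$) and $\varepsilon_*(x_{i,j}) = x_{i,\varepsilon(j)}$ for $\varepsilon\colon[m]\to[n]$; every variable has degree one. An $\mathrm{OI}$-module $\mathbf{M}$ over $\mathbf{P}$ is a functor from $\mathrm{OI}$ to $K$-vector spaces such that each $\mathbf{M}_n = \mathbf{M}([n])$ is a $\mathbf{P}_n$-module and $\mathbf{M}(\varepsilon)(aq) = \varepsilon_*(a)\mathbf{M}(\varepsilon)(q)$; elements of $\mathbf{M}_n$ are said to have width $n$. For $d\ge0$, $\mathbf{F}^{\mathrm{OI},d}$ is the $\mathrm{OI}$-module with $\mathbf{F}^{\mathrm{OI},d}_m = \bigoplus_{\pi\in\mathrm{Hom}_{\mathrm{OI}}([d],[m])}\mathbf{P}_m e_\pi$ and $\mathbf{F}^{\mathrm{OI},d}(\varepsilon)(a e_\pi) = \varepsilon_*(a)e_{\varepsilon\circ\pi}$, graded by giving every $e_\pi$ degree $0$. A monomial of $\mathbf{F}^{\mathrm{OI},d}$ of width $m$ is an element $x^u e_\pi$ with $x^u$ a monomial of $\mathbf{P}_m$. A monomial submodule is an $\mathrm{OI}$-submodule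 generated by monomials; it has a unique minimal generating set consisting of monomials, whose elements are its monomial minimal generators. It is said to be generated in width $m$ if all of its monomial minimal generators have width at most $m$. For a finitely generated submodule $T$ of a free $\mathbf{P}_n$-module generated by monomials, $e^+(T)$ is the largest degree of a minimal monomial generator of $T$ if $T\ne0$, and $e^+(0) = -\infty$ (a sum $\sum_{k=0}^{-\infty}$ is empty, i.e. $0$). For $e\in\mathbb{N}_0^c$, $x_{\cdot,1}^e = x_{1,1}^{e_1}\cdots x_{c,1}^{e_c}$, and $\mathbf{M}_n : x_{\cdot,1}^e = \{q\in\mathbf{F}_n : x_{\cdot,1}^e q\in\mathbf{M}_n\}$. The expression $\mathbf{M}_n : x_{\cdot, 1}^e + \mathbf{x}_1 \mathbf{F}_n$ means $(\mathbf{M}_n : x_{\cdot,1}^e)+\mathbf{x}_1\mathbf{F}_n$, where $\mathbf{x}_1$ is the ideal of $\mathbf{P}_n$ generated by $x_{1,1},\dots,x_{c,1}$. Modules over $\mathbf{P}_n/\mathbf{x}_1\mathbf{P}_n$ are regarded as $\mathbf{P}_{n-1}$-modules via the graded $K$-algebra isomorphism $\mathbf{P}_{n-1}\cong\mathbf{P}_n/\mathbf{x}_1\mathbf{P}_n$ sending $x_{i,j}$ to the class of $x_{i,j+1}$. $[\ ]_k$ denotes the degree $k$ component. Components in negative width are zero. *)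

(* Defs.v *)
From HB Require Import structures.
From mathcomp Require Import all_boot all_order all_algebra.
From mathcomp Require Import boolp classical_sets.
From mathcomp Require Import mpoly.

Set Implicit Arguments.
Unset Strict Implicit.
Unset Printing Implicit Defensive.

Import GRing.Theory.
Local Open Scope ring_scope.
Local Open Scope quotient_scope.

(* [zmodset N] is [N] itself; the alias carries the [zmodClosed] structure that
   the library's quotient of abelian groups asks for. *)
Definition zmodset (R : comNzRingType) (V : lmodType R) (N : submodClosed V) :
  {pred V} := N.

Fact zmodset_closed (R : comNzRingType) (V : lmodType R) (N : submodClosed V) :
  zmod_closed (zmodset N).
Proof.
split=> [|x y xN yN]; first exact: (rpred0 N).
by apply: (rpredD (S := N)) => //; rewrite -scaleN1r; apply: (rpredZ (s := N)).
Qed.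
HB.instance Definition _ (R : comNzRingType) (V : lmodType R)
  (N : submodClosed V) := GRing.isZmodClosed.Build V (zmodset N)
    (zmodset_closed N).

Definition modquot (R : comNzRingType) (V : lmodType R) (N : submodClosed V) :=
  Quotient.quot (zmodset N).

Section ModQuot.
Variables (R : comNzRingType) (V : lmodType R) (N : submodClosed V).

HB.instance Definition _ := Choice.on (modquot N).
HB.instance Definition _ := GRing.Zmodule.on (modquot N).

Definition modquot_pi (v : V) : modquot N := \pi_(Quotient.quot (zmodset N)) v.

Definition modquot_scale (a : R) (x : modquot N) : modquot N :=
  modquot_pi (a *: repr (x : Quotient.quot (zmodset N))).

Lemma modquot_piD : {morph modquot_pi : u v / u + v}.
Proof. by move=> u v; rewrite /modquot_pi piE. Qed.

Lemma modquot_eqP (u v : V) : modquot_pi u = modquot_pi v <-> u - v \in N.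
Proof.
rewrite -[_ \in N]/(u - v \in zmodset N) Quotient.idealrBE.
by split=> [/eqP|/eqP].
Qed.

Lemma modquot_reprK (x : modquot N) :
  modquot_pi (repr (x : Quotient.quot (zmodset N))) = x.
Proof. exact: reprK. Qed.

Lemma modquot_scale_pi (a : R) (v : V) :
  modquot_scale a (modquot_pi v) = modquot_pi (a *: v).
Proof.
apply/modquot_eqP; rewrite -scalerBr; apply: (rpredZ (s := N)).
by apply/modquot_eqP; rewrite modquot_reprK.
Qed.

Fact modquot_scaleA a b x :
  modquot_scale a (modquot_scale b x) = modquot_scale (a * b) x.
Proof. by rewrite -[x]modquot_reprK !modquot_scale_pi scalerA. Qed.
Fact modquot_scale1 : left_id 1 modquot_scale.
Proof. by move=> x; rewrite -[x]modquot_reprK modquot_scale_pi scale1r. Qed.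
Fact modquot_scaleDr : right_distributive modquot_scale +%R.
Proof.
move=> a x y; rewrite -[x]modquot_reprK -[y]modquot_reprK.
by rewrite -modquot_piD !modquot_scale_pi -modquot_piD scalerDr.
Qed.
Fact modquot_scaleDl x : {morph modquot_scale^~ x : a b / a + b}.
Proof.
by move=> a b; rewrite -[x]modquot_reprK !modquot_scale_pi -modquot_piD scalerDl.
Qed.
HB.instance Definition _ := GRing.Zmodule_isLmodule.Build R (modquot N)
  modquot_scaleA modquot_scale1 modquot_scaleDr modquot_scaleDl.

End ModQuot.

Definition add_pred (R : comNzRingType) (V : lmodType R)
  (N N' : submodClosed V) : {pred V} :=
  fun v => `[< exists x y, [/\ x \in N, y \in N' & v = x + y] >].

Fact add_pred_closed (R : comNzRingType) (V : lmodType R)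
  (N N' : submodClosed V) : submod_closed (add_pred N N').
Proof.
split=> [|a _ _ /asboolP[x [y [xN yN ->]]] /asboolP[x' [y' [x'N y'N ->]]]].
  by apply/asboolP; exists 0, 0; rewrite !rpred0 addr0.
apply/asboolP; exists (a *: x + x'), (a *: y + y').
by rewrite !rpredD ?rpredZ // scalerDr addrACA; split.
Qed.
HB.instance Definition _ (R : comNzRingType) (V : lmodType R)
  (N N' : submodClosed V) :=
  GRing.isSubmodClosed.Build R V (add_pred N N') (add_pred_closed N N').

Definition submod_add (R : comNzRingType) (V : lmodType R)
  (N N' : submodClosed V) : submodClosed V := add_pred N N'.

Definition colon_pred (R : comNzRingType) (V : lmodType R)
  (N : submodClosed V) (a : R) : {pred V} := fun v => a *: v \in N.

Fact colon_pred_closed (R : comNzRingType) (V : lmodType R)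
  (N : submodClosed V) (a : R) : submod_closed (colon_pred N a).
Proof.
have colonE v : (v \in colon_pred N a) = (a *: v \in N) by [].
split=> [|b x y]; rewrite !colonE ?scaler0 ?rpred0 // => xN yN.
by rewrite scalerDr scalerA mulrC -scalerA rpredD // rpredZ.
Qed.
HB.instance Definition _ (R : comNzRingType) (V : lmodType R)
  (N : submodClosed V) (a : R) :=
  GRing.isSubmodClosed.Build R V (colon_pred N a) (colon_pred_closed N a).

Definition colon (R : comNzRingType) (V : lmodType R)
  (N : submodClosed V) (a : R) : submodClosed V := colon_pred N a.

Definition idealmul_pred (R : comNzRingType) (V : lmodType R) r
  (a : 'I_r -> R) : {pred V} :=
  fun v => `[< exists w : 'I_r -> V, v = \sum_(i < r) a i *: w i >].

Fact idealmul_pred_closed (R : comNzRingType) (V : lmodType R) r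
  (a : 'I_r -> R) : submod_closed (@idealmul_pred R V r a).
Proof.
split=> [|b _ _ /asboolP[w ->] /asboolP[w' ->]]; apply/asboolP.
  by exists (fun=> 0); rewrite big1 // => i _; rewrite scaler0.
exists (fun i => b *: w i + w' i); rewrite scaler_sumr -big_split /=.
by apply: eq_bigr => i _; rewrite scalerDr !scalerA mulrC.
Qed.
HB.instance Definition _ (R : comNzRingType) (V : lmodType R) r
  (a : 'I_r -> R) := GRing.isSubmodClosed.Build R V (@idealmul_pred R V r a)
    (@idealmul_pred_closed R V r a).

(* The submodule [(a_1, ..., a_r) V] of [V]. *)
Definition idealmul (R : comNzRingType) (V : lmodType R) r (a : 'I_r -> R) :
  submodClosed V := @idealmul_pred R V r a.

Definition restr (R S : comNzRingType) (f : {rmorphism R -> S})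
  (V : lmodType S) : Type := V.

Section Restr.
Variables (R S : comNzRingType) (f : {rmorphism R -> S}) (V : lmodType S).

HB.instance Definition _ := GRing.Zmodule.on (restr f V).

Definition restr_scale (a : R) (v : restr f V) : restr f V :=
  f a *: (v : V).

Fact restr_scaleA a b v :
  restr_scale a (restr_scale b v) = restr_scale (a * b) v.
Proof. by rewrite /restr_scale scalerA rmorphM. Qed.
Fact restr_scale1 : left_id 1 restr_scale.
Proof. by move=> v; rewrite /restr_scale rmorph1 scale1r. Qed.
Fact restr_scaleDr : right_distributive restr_scale +%R.
Proof. by move=> a u v; rewrite /restr_scale scalerDr. Qed.
Fact restr_scaleDl v : {morph restr_scale^~ v : a b / a + b}.
Proof. by move=> a b; rewrite /restr_scale rmorphD scalerDl. Qed.
HB.instance Definition _ := GRing.Zmodule_isLmodule.Build R (restr f V)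
  restr_scaleA restr_scale1 restr_scaleDr restr_scaleDl.

End Restr.

(* [gV k] and [gW k] are the degree [k] components of [V] and [W]. *)
Definition graded_iso (R : comNzRingType) (V W : lmodType R)
  (gV : nat -> set V) (gW : nat -> set W) : Prop :=
  exists phi : {linear V -> W},
    bijective phi /\ forall k v, gV k v <-> gW k (phi v).

(* [r] is the dimension of the subspace [W] of the [K]-vector space [V]. *)
Definition is_dim (K : fieldType) (V : lmodType K) (W : set V) (r : nat) :
  Prop :=
  exists b : 'I_r -> V,
    [/\ forall i, W (b i),
        forall a : 'I_r -> K, \sum_(i < r) a i *: b i = 0 -> forall i, a i = 0
      & forall w, W w -> exists a : 'I_r -> K, w = \sum_(i < r) a i *: b i].

(* Only meaningful for finite-dimensional [W]; the default value is [0]. *)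
Definition dim (K : fieldType) (V : lmodType K) (W : set V) : nat :=
  xget 0%N (is_dim W).

Definition generates (R : comNzRingType) (V : lmodType R) (S : set V)
  (T : submodClosed V) : Prop :=
  (forall v, S v -> v \in T) /\
  forall T' : submodClosed V,
    (forall v, S v -> v \in T') -> {subset T <= T'}.

Definition strict_mono m n (f : {ffun 'I_m -> 'I_n}) : bool :=
  [forall i : 'I_m, forall j : 'I_m, (i < j)%N ==> (f i < f j)%N].

(* The object [[n] = {1, ..., n}] of OI is represented by ['I_n]: indices are
   shifted by one, and the element [1] of [[n]] is [ord0]. *)
Definition OIhom m n : Type := {f : {ffun 'I_m -> 'I_n} | strict_mono f}.
HB.instance Definition _ m n := Finite.on (OIhom m n).

Lemma strict_monoP m n (f : {ffun 'I_m -> 'I_n}) :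
  reflect (forall i j : 'I_m, (i < j)%N -> (f i < f j)%N) (strict_mono f).
Proof.
apply: (iffP idP) => [/forallP H i j|H].
  by have /forallP/(_ j)/implyP := H i.
by apply/forallP => i; apply/forallP => j; apply/implyP/H.
Qed.

Fact OIid_subproof n : strict_mono [ffun i : 'I_n => i].
Proof. by apply/strict_monoP => i j; rewrite !ffunE. Qed.
Definition OIid n : OIhom n n :=
  exist (fun f => strict_mono f) _ (OIid_subproof n).

Fact OIcomp_subproof m n p (g : OIhom n p) (f : OIhom m n) :
  strict_mono [ffun i => val g (val f i)].
Proof.
apply/strict_monoP => i j ij; rewrite !ffunE.
by apply: (strict_monoP _ (valP g)); apply: (strict_monoP _ (valP f)).
Qed.
Definition OIcomp m n p (g : OIhom n p) (f : OIhom m n) : OIhom m p :=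
  exist (fun f => strict_mono f) _ (OIcomp_subproof g f).

Fact OIshift_subproof n : strict_mono [ffun j : 'I_n => lift ord0 j].
Proof. by apply/strict_monoP => i j ij; rewrite !ffunE !lift0. Qed.

(* The induced map [P_n -> P_{n+1}], [x_{i,j} |-> x_{i,j+1}], followed by the
   projection onto [P_{n+1} / x_1 P_{n+1}], is the isomorphism through which
   modules killed by [x_1] become [P_n]-modules: their [P_n]-structure is thus
   the restriction of scalars along that induced map. *)
Definition OIshift n : OIhom n n.+1 :=
  exist (fun f => strict_mono f) _ (OIshift_subproof n).

Section OI.
Variables (K : fieldType) (c : nat).

(* [P_n = K[x_{i,j} : i <= c, j <= n]], the pair [(i, j)] being encoded by its
   rank in the enumeration of ['I_c * 'I_n]. *)
Definition OIP n := {mpoly K[#|{: 'I_c * 'I_n}|]}.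
HB.instance Definition _ n := GRing.ComNzRing.on (OIP n).

Definition OIvar n (i : 'I_c) (j : 'I_n) : OIP n := 'X_(enum_rank (i, j)).

Definition OIvars m n (eps : OIhom m n) :
  #|{: 'I_c * 'I_m}|.-tuple {mpoly K[#|{: 'I_c * 'I_n}|]} :=
  [tuple OIvar (enum_val k).1 (val eps (enum_val k).2)
  | k < #|{: 'I_c * 'I_m}|].

(* [eps_* : P_m -> P_n], [x_{i,j} |-> x_{i,eps(j)}]. *)
Definition OIPmap m n (eps : OIhom m n) : OIP m -> OIP n :=
  comp_mpoly (OIvars eps).
HB.instance Definition _ m n (eps : OIhom m n) :=
  GRing.RMorphism.copy (OIPmap eps) (comp_mpoly (OIvars eps)).

Lemma OIPmap_var m n (eps : OIhom m n) i j :
  OIPmap eps (OIvar i j) = OIvar i (val eps j).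
Proof. by rewrite /OIPmap comp_mpolyXU -tnth_nth tnth_mktuple enum_rankK. Qed.

Lemma OIPmap_id n (p : OIP n) : OIPmap (OIid n) p = p.
Proof.
rewrite /OIPmap -[RHS]comp_mpoly_id; congr comp_mpoly.
apply: eq_from_tnth => k; rewrite !tnth_mktuple /= ffunE /OIvar.
by rewrite -surjective_pairing enum_valK.
Qed.

Lemma OIPmap_comp m n p (g : OIhom n p) (f : OIhom m n) (a : OIP m) :
  OIPmap (OIcomp g f) a = OIPmap g (OIPmap f a).
Proof.
rewrite /OIPmap [in LHS](mpolyE a) [in RHS](mpolyE a) [LHS]raddf_sum.
rewrite [X in comp_mpoly _ X]raddf_sum [RHS]raddf_sum; apply: eq_bigr => u _ /=.
rewrite !linearZ /= !comp_mpolyX; congr (_ *: _).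
rewrite (rmorph_prod (comp_mpoly (OIvars g))); apply: eq_bigr => k _.
rewrite rmorphXn /= !tnth_mktuple /OIvar comp_mpolyXU -tnth_nth tnth_mktuple.
by rewrite enum_rankK ffunE.
Qed.

(* Indices of the basis [e_pi] of the free module of rank one in width [m]:
   [Some d] stands for F^{OI,d}, and [None] for the zero OI-module. *)
Definition OIbasis (d : option nat) (m : nat) : finType :=
  if d is Some d' then OIhom d' m else void.

Definition OIbasis_map d m n (eps : OIhom m n) :
  OIbasis d m -> OIbasis d n :=
  match d return OIbasis d m -> OIbasis d n with
  | Some d' => fun pi : OIhom d' m => OIcomp eps pi
  | None => id
  end.

Lemma OIbasis_map_id d n : OIbasis_map (d:=d) (OIid n) =1 id.
Proof.
case: d => [d|] //= pi; apply: val_inj; apply/ffunP => i /=; by rewrite !ffunE.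
Qed.

Lemma OIbasis_map_comp d m n p (g : OIhom n p) (f : OIhom m n)
    (b : OIbasis d m) :
  OIbasis_map (OIcomp g f) b = OIbasis_map g (OIbasis_map f b).
Proof.
case: d b => [d|] //= pi; apply: val_inj; apply/ffunP => i /=; by rewrite !ffunE.
Qed.

(* A finite function [q] represents the element [sum_pi q(pi) e_pi]. *)
Definition OIfree d n := {ffun OIbasis d n -> (OIP n)^o}.
HB.instance Definition _ d n := GRing.Lmodule.on (OIfree d n).

(* [sum_pi q(pi) e_pi |-> sum_pi eps_*(q(pi)) e_{eps o pi}]. *)
Definition OIfree_map d m n (eps : OIhom m n) (q : OIfree d m) : OIfree d n :=
  [ffun rho => \sum_(pi | OIbasis_map eps pi == rho) OIPmap eps (q pi)].

Lemma OIfree_mapD d m n (eps : OIhom m n) :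
  {morph @OIfree_map d m n eps : x y / x + y}.
Proof.
move=> x y; apply/ffunP => r; rewrite !ffunE -big_split; apply: eq_bigr => i _.
by rewrite ffunE rmorphD.
Qed.

Lemma OIfree_mapZ d m n (eps : OIhom m n) (a : OIP m) (q : OIfree d m) :
  OIfree_map eps (a *: q) = OIPmap eps a *: OIfree_map eps q.
Proof.
apply/ffunP => r; rewrite !ffunE scaler_sumr; apply: eq_bigr => i _.
by rewrite ffunE; exact: (rmorphM (OIPmap eps)).
Qed.

Lemma OIfree_map_id d n (q : OIfree d n) : OIfree_map (OIid n) q = q.
Proof.
apply/ffunP => r; rewrite ffunE.
under eq_bigl do rewrite OIbasis_map_id.
by rewrite big_pred1_eq OIPmap_id.
Qed.

Lemma OIfree_map_comp d m n p (g : OIhom n p) (f : OIhom m n)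
    (q : OIfree d m) :
  OIfree_map (OIcomp g f) q = OIfree_map g (OIfree_map f q).
Proof.
apply/ffunP => r; rewrite !ffunE.
rewrite [LHS](partition_big (OIbasis_map f)
  (fun s => OIbasis_map g s == r)) /=; last first.
  by move=> b; rewrite OIbasis_map_comp.
apply: eq_bigr => s /eqP <-; rewrite ffunE raddf_sum.
apply: eq_big => [b|b _]; last exact: OIPmap_comp.
rewrite OIbasis_map_comp.
by case: (eqVneq (OIbasis_map f b) s) => [->|]; rewrite ?eqxx ?andbF.
Qed.

Lemma OIfree_map_mon d m n (eps : OIhom m n) (a : OIP m) (b : OIbasis d m) :
  OIfree_map eps ([ffun r => if r == b then a else 0] : OIfree d m) =
  [ffun r => if r == OIbasis_map eps b then OIPmap eps a else 0].
Proof.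
apply/ffunP => r; rewrite !ffunE; case: eqVneq => [->|E].
  rewrite (bigD1 b) //= ffunE eqxx big1 ?addr0 // => i /andP[_ /negPf H].
  by rewrite ffunE H rmorph0.
rewrite big1 // => i /eqP Er; rewrite ffunE; case: eqP Er => [->|_ _].
  by move=> Er; rewrite Er eqxx in E.
by rewrite rmorph0.
Qed.

(* The monomial [x^u e_pi]. *)
Definition OImon d n (u : 'X_{1..#|{: 'I_c * 'I_n}|}) (pi : OIbasis d n) :
  OIfree d n := [ffun rho => if rho == pi then 'X_[u] else 0].

Definition is_OImon d n (q : OIfree d n) : Prop :=
  exists u pi, q = OImon u pi.

(* The degree [k] component of the free module; every [e_pi] has degree [0]. *)
Definition free_deg d n (k : nat) : set (OIfree d n) :=
  fun q => forall pi, (q pi : OIP n) \is k.-homog.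

(* The degree [k] component of the quotient of the free module by a graded
   submodule. *)
Definition quot_deg d n (N : submodClosed (OIfree d n)) (k : nat) :
  set (modquot N) :=
  fun x => exists q, free_deg k q /\ x = modquot_pi N q.

Record OIsubmod d := MkOIsubmod {
  OIsub_at :> forall n, submodClosed (OIfree d n);
  OIsub_map : forall m n (eps : OIhom m n) (q : OIfree d m),
    q \in OIsub_at m -> OIfree_map eps q \in OIsub_at n }.

Definition OIgenerates d (S : forall n, set (OIfree d n)) (M : OIsubmod d) :
  Prop :=
  (forall n q, S n q -> q \in M n) /\
  forall M' : OIsubmod d, (forall n q, S n q -> q \in M' n) ->
    forall n, {subset M n <= M' n}.

Definition OImonomial d (M : OIsubmod d) : Prop :=
  exists S : forall n, set (OIfree d n),
    (forall n q, S n q -> is_OImon q) /\ OIgenerates S M.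

Definition OImin_mon_gens d (S : forall n, set (OIfree d n)) (M : OIsubmod d) :
  Prop :=
  [/\ forall n q, S n q -> is_OImon q,
      OIgenerates S M
    & forall S' : forall n, set (OIfree d n),
        (forall n q, S' n q -> S n q) -> OIgenerates S' M ->
        forall n q, S n q -> S' n q].

(* [q] is a monomial minimal generator of [M], of width [n]. *)
Definition OImin_mon_gen d (M : OIsubmod d) n (q : OIfree d n) : Prop :=
  exists S, OImin_mon_gens S M /\ S n q.

(* The bound is an integer, as it may be [-1] (no generators at all). *)
Definition generated_in_width d (M : OIsubmod d) (w : int) : Prop :=
  forall n (q : OIfree d n), OImin_mon_gen M q -> (n%:Z <= w)%R.

Definition min_mon_gens d n (S : set (OIfree d n))
  (T : submodClosed (OIfree d n)) : Prop :=
  [/\ forall q, S q -> is_OImon q,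
      generates S T
    & forall S' : set (OIfree d n),
        (forall q, S' q -> S q) -> generates S' T -> forall q, S q -> S' q].

Definition min_mon_gen d n (T : submodClosed (OIfree d n)) (q : OIfree d n) :
  Prop := exists S, min_mon_gens S T /\ S q.

Definition is_max_gen_deg d n (T : submodClosed (OIfree d n)) (k : nat) :
  Prop :=
  (exists u (pi : OIbasis d n), min_mon_gen T (OImon u pi) /\ mdeg u = k) /\
  forall u (pi : OIbasis d n), min_mon_gen T (OImon u pi) -> (mdeg u <= k)%N.

(* [None] stands for [-oo]. *)
Definition eplus d n (T : submodClosed (OIfree d n)) : option nat :=
  if `[< forall q, q \in T -> q = 0 >] then None
  else Some (xget 0%N (is_max_gen_deg T)).

(* [dim_K [F_n / T]_k], the [K]-vector space structure being the restriction of
   the [P_n]-module structure. *)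
Definition hilb d n (T : submodClosed (OIfree d n)) (k : nat) : nat :=
  dim (quot_deg (N := T) k :
    set (restr (@mpolyC #|{: 'I_c * 'I_n}| K) (modquot T))).

(* [sum_{k = 0}^{e^+(T)} dim_K [F_n / T]_k]. *)
Definition hilb_sum d n (T : submodClosed (OIfree d n)) : nat :=
  if eplus T is Some e then (\sum_(0 <= k < e.+1) hilb T k)%N else 0%N.

(* [x_{.,1}^e] in [P_{n+1}]. *)
Definition xpow n (e : 'I_c -> nat) : OIP n.+1 :=
  \prod_(i < c) OIvar i ord0 ^+ e i.

(* [(M_{n+1} : x_{.,1}^e) + x_1 F_{n+1}]. *)
Definition colon_plus d (M : OIsubmod d) (e : 'I_c -> nat) n :
  submodClosed (OIfree d n.+1) :=
  submod_add (colon (M n.+1) (xpow n e))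
    (idealmul (OIfree d n.+1) (fun i : 'I_c => OIvar i (ord0 : 'I_n.+1))).

Definition sum_deg d d' n (N : submodClosed (OIfree d n))
  (N' : submodClosed (OIfree d' n)) (k : nat) :
  set (modquot N * modquot N')%type :=
  fun x => quot_deg k x.1 /\ quot_deg k x.2.

End OI.

(* F^{OI,d-1} if d >= 1, and [0] if d = 0. *)
Definition OIpred (d : nat) : option nat :=
  if d is d'.+1 then Some d' else None.

(* Main.v *)
Require Import Defs.
From HB Require Import structures.
From mathcomp Require Import all_boot all_order all_algebra.
From mathcomp Require Import boolp classical_sets.
From mathcomp Require Import mpoly.
From mathcomp Require Import zify.

(** Everything is read off monomials: a monomial submodule is spanned by the
    monomials it contains, and a monomial OI-submodule is the same thing as a
    set of monomials, of all widths, closed under multiples and under the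
    morphisms of OI ([OIspan], [OIgenerates_mdvd]).

    In width [n+1] the basis elements [e_pi] are of two kinds. Those with
    [pi 1 = 1] correspond to the basis of [G_n] ([OIbasis_ext]), those with
    [pi 1 > 1] to the basis of [F_n] ([OIbasis_shift]). Modulo [x_1] only the
    monomials without variables of the first column survive, so the quotient of
    [F_(n+1)] by [(M : x_1^e) + x_1 F] has as a basis the [x^u e_pi] with [u]
    zero on the first column and [x_1^e x^u e_pi] outside of [M]. Deleting the
    first column turns the two kinds into the standard monomials of two
    modules: [Q'], spanned by the monomials of [G_n], and [Q''], spanned by
    those of [F_n], which land in [M] once they are shifted and multiplied by
    [x_1^e]. Setting the variables of the first column to zero ([unshift])
    realizes this bijection by a module isomorphism ([colon_plus_iso]). Below
    width [m], which this isomorphism is not about, [Q''] is replaced by zero.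

    The bounds on widths come from counting. If [x_1^e] times the shift of a
    monomial of width [n+1] is divisible by the image of a generator of [M] of
    width [k <= m] under [f : [k] -> [n+2]], a point other than [1] that [f]
    misses can be deleted from the monomial ([colon_mon_descent]). There is one if [k <= n], and also
    if [k <= n+1] and [1] is in the image of [f], which is automatic when
    [pi 1 = 1]. This is where [Q'] gains one unit of width over [Q''].

    For the inequality, [M_m] is contained in [Q''_m], and a minimal generator
    of [Q''_m] has at most the degree of some minimal generator of [M_m]
    ([colon_shift_min_mon]). Hence [e^+(Q''_m) <= e^+(M_m)], and the sums can be
    compared term by term. If they are equal, then [M_m] and [Q''_m] agree in
    all degrees in which [Q''_m] has generators, so they are equal
    ([hilb_sum_le]); both modules being generated in width [m], they agree from
    there on ([eq_from_width]). That the largest degree of a generator exists is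
    Dickson's lemma ([antichain_mdeg]). *)

Set Implicit Arguments.
Unset Strict Implicit.
Unset Printing Implicit Defensive.

Import GRing.Theory.
Local Open Scope ring_scope.

(** * Strictly increasing maps *)

Lemma OIhom_eq m n (f g : OIhom m n) : (forall i, val f i = val g i) -> f = g.
Proof. by move=> fg; apply/val_inj/ffunP. Qed.

Lemma OIhomE m n (f : OIhom m n) (i j : 'I_m) : (val f i < val f j)%N = (i < j)%N.
Proof.
have fP := strict_monoP _ (valP f).
case: (ltngtP i j) => [/fP-> //|/fP fji|/val_inj->]; last by rewrite ltnn.
by rewrite ltnNge ltnW.
Qed.

Lemma OIhom_inj m n (f : OIhom m n) : injective (val f).
Proof.
move=> i j fij; apply: val_inj; have := OIhomE f i j; have := OIhomE f j i.
by rewrite fij ltnn; case: ltngtP.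
Qed.

Lemma OIhom_leq m n : OIhom m n -> (m <= n)%N.
Proof.
by move=> f; have := leq_card _ (@OIhom_inj _ _ f); rewrite !card_ord.
Qed.

Lemma OIcompE m n p (g : OIhom n p) (f : OIhom m n) i :
  val (OIcomp g f) i = val g (val f i).
Proof. by rewrite ffunE. Qed.

Lemma OIshiftE n i : val (OIshift n) i = lift ord0 i.
Proof. by rewrite ffunE. Qed.

Fact OIlift_subproof n (j : 'I_n.+1) : strict_mono [ffun i : 'I_n => lift j i].
Proof.
apply/strict_monoP => i k ik; rewrite !ffunE /= /bump.
by case: (leqP j i) => ji; case: (leqP j k) => jk; lia.
Qed.

Definition OIlift n (j : 'I_n.+1) : OIhom n n.+1 :=
  exist (fun f => strict_mono f) _ (OIlift_subproof j).

Lemma OIliftE n (j : 'I_n.+1) i : val (OIlift j) i = lift j i.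
Proof. by rewrite ffunE. Qed.

Lemma OIhom_lift k n (f : OIhom k n.+1) (j : 'I_n.+1) :
  (forall i, val f i != j) -> exists g, f = OIcomp (OIlift j) g.
Proof.
move=> fj.
have gP i : exists h : 'I_n, val f i = lift j h.
  by have /unlift_some[h hE _] : j != val f i; [rewrite eq_sym fj|exists h].
have [g gE] := fin_all_exists gP.
have g_mono : strict_mono (finfun g).
  apply/strict_monoP => a b; rewrite -(OIhomE f a b) !gE !ffunE /= /bump.
  by case: (leqP j (g a)) => ja; case: (leqP j (g b)) => jb; lia.
exists (exist (fun f => strict_mono f) _ g_mono : OIhom k n); apply: OIhom_eq => i.
by rewrite OIcompE OIliftE ffunE gE.
Qed.

Fact OIext_subproof m n (f : OIhom m n) :
  strict_mono [ffun i : 'I_m.+1 =>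
    if unlift ord0 i is Some j then lift ord0 (val f j) else ord0].
Proof.
apply/strict_monoP => i j; rewrite !ffunE.
case: (unliftP ord0 i) => [i' ->|->]; case: (unliftP ord0 j) => [j' ->|->] //.
by rewrite !lift0 !ltnS OIhomE.
Qed.

(** [OIext] is the functor that adds a new first point, and [OIshift] is a natural
    transformation from the identity to it, see [OIext_shift]. *)
Definition OIext m n (f : OIhom m n) : OIhom m.+1 n.+1 :=
  exist (fun f => strict_mono f) _ (OIext_subproof f).

Lemma OIext0 m n (f : OIhom m n) : val (OIext f) ord0 = ord0.
Proof. by rewrite ffunE unlift_none. Qed.

Lemma OIextS m n (f : OIhom m n) i :
  val (OIext f) (lift ord0 i) = lift ord0 (val f i).
Proof. by rewrite ffunE liftK. Qed.

Lemma OIext_shift m n (f : OIhom m n) :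
  OIcomp (OIext f) (OIshift m) = OIcomp (OIshift n) f.
Proof. by apply: OIhom_eq => i; rewrite !OIcompE !OIshiftE OIextS. Qed.

Lemma OIext_comp m n p (g : OIhom n p) (f : OIhom m n) :
  OIext (OIcomp g f) = OIcomp (OIext g) (OIext f).
Proof.
apply: OIhom_eq => i; rewrite OIcompE.
by case: (unliftP ord0 i) => [j ->|->]; rewrite ?OIext0 // !OIextS OIcompE.
Qed.

Lemma OIext_inj m n : injective (@OIext m n).
Proof.
move=> f g fg; apply: OIhom_eq => i; apply: (@lift_inj _ ord0).
by rewrite -!OIextS fg.
Qed.

Lemma OIshift_inj m n : injective (fun f : OIhom m n => OIcomp (OIshift n) f).
Proof.
move=> f g /(congr1 val)/ffunP fg; apply: OIhom_eq => i.
by have := fg i; rewrite !OIcompE !OIshiftE => /lift_inj.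
Qed.

Lemma OIhom_first m n (f : OIhom m.+1 n.+1) i : val f i = ord0 -> i = ord0.
Proof.
move=> fi; have := OIhomE f ord0 i; rewrite fi ltn0 lt0n => /esym/negbFE/eqP i0.
exact: val_inj.
Qed.

Lemma OIhom_shift m n (f : OIhom m n.+1) :
  (forall i, val f i != ord0) -> exists g, f = OIcomp (OIshift n) g.
Proof.
move=> /OIhom_lift[g ->]; exists g; apply: OIhom_eq => i.
by rewrite !OIcompE OIliftE ?OIshiftE.
Qed.

Lemma OIhom_ext m n (f : OIhom m.+1 n.+1) :
  val f ord0 = ord0 -> exists g, f = OIext g.
Proof.
move=> f0; have [|g gE] := @OIhom_shift _ n (OIcomp f (OIshift m)).
  move=> i; rewrite OIcompE OIshiftE -f0 (inj_eq (@OIhom_inj _ _ f)).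
  by rewrite eq_sym neq_lift.
exists g; apply: OIhom_eq => i.
case: (unliftP ord0 i) => [j ->|->]; rewrite ?OIext0 // OIextS.
by rewrite -!OIshiftE -!OIcompE gE.
Qed.

(** There is a point outside the image of [f] and different from the first one,
    as [f] and the first point together reach at most [n.+1] points; the first
    factor skips it. *)
Lemma OIhom_factor k n (f : OIhom k n.+2) : (k <= n.+1)%N ->
  (exists i, val f i = ord0) \/ (k <= n)%N ->
  exists (g : OIhom n n.+1) (h : OIhom k n.+1), f = OIcomp (OIext g) h.
Proof.
move=> kn hk.
have [j] : exists j, j \notin ord0 |: [set val f i | i : 'I_k].
  apply/existsP; rewrite -negb_forall; apply/negP => /forallP jP.
  have : (#|{: 'I_n.+2}| <= #|ord0 |: [set val f i | i : 'I_k]|)%N.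
    by apply: subset_leq_card; apply/fintype.subsetP => j _; apply: jP.
  rewrite card_ord cardsU1 card_imset ?card_ord; last exact: OIhom_inj.
  case: hk => [[i fi]|]; last by case: (_ \in _) => /=; lia.
  by rewrite -fi imset_f //=; lia.
rewrite !inE negb_or => /andP[j0 jP].
have [h fE] : exists h, f = OIcomp (OIlift j) h.
  by apply: OIhom_lift => i; apply: contra jP => /eqP<-; rewrite imset_f.
have [g gE] : exists g, OIlift j = OIext g.
  apply: OIhom_ext; rewrite OIliftE; apply: val_inj => /=.
  by rewrite /bump leqNgt lt0n j0.
by exists g, h; rewrite fE gE.
Qed.

Lemma OIhom_factor1 k n (f : OIhom k n.+1) : (k <= n)%N ->
  exists (g : OIhom n n.+1) (h : OIhom k n), f = OIcomp g h.
Proof.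
(* The image of [OIext f] contains the first point, so that [k <= n] is enough. *)
move=> kn; have [||g [h fE]] := @OIhom_factor k.+1 n (OIext f); first by [].
  by left; exists ord0; rewrite OIext0.
have [|h' hE] := OIhom_ext (f := h).
  by apply: (OIhom_inj (f := OIext g)); rewrite -OIcompE -fE !OIext0.
by exists g, h'; apply: OIext_inj; rewrite fE hE OIext_comp.
Qed.

Lemma OIhom_through k m n (f : OIhom k n) : (k <= m)%N -> (m <= n)%N ->
  exists (g : OIhom m n) (h : OIhom k m), f = OIcomp g h.
Proof.
move=> km mn; move: f; rewrite -(subnK mn); elim: (n - m)%N => [|r IHr] f.
  by exists (OIid m), f; apply: OIhom_eq => i; rewrite OIcompE ffunE.
have [|g [h ->]] := OIhom_factor1 f; first exact: leq_trans (leq_addl _ _).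
have [g' [h' ->]] := IHr h; exists (OIcomp g g'), h'.
by apply: OIhom_eq => i; rewrite !OIcompE.
Qed.

(** * Basis elements with and without the first point *)

(** The basis elements [e_pi] of width [n.+1] with [pi 1 = 1]. *)
Definition OIbasis_ext d n : OIbasis (OIpred d) n -> OIbasis (Some d) n.+1 :=
  match d return OIbasis (OIpred d) n -> OIbasis (Some d) n.+1 with
  | 0 => fun v => match v with end
  | _.+1 => fun pi => OIext pi
  end.

(** The basis elements [e_pi] of width [n.+1] with [pi 1 > 1]. *)
Definition OIbasis_shift d n : OIbasis (Some d) n -> OIbasis (Some d) n.+1 :=
  OIbasis_map (d := Some d) (OIshift n).

Lemma OIbasis_ext_inj d n : injective (@OIbasis_ext d n).
Proof. by case: d => [|d]; [case|apply: OIext_inj]. Qed.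

Lemma OIbasis_shift_inj d n : injective (@OIbasis_shift d n).
Proof. exact: OIshift_inj. Qed.

Lemma OIbasis_ext_map d m n (f : OIhom m n) (b : OIbasis (OIpred d) m) :
  OIbasis_ext (OIbasis_map f b) = OIbasis_map (OIext f) (OIbasis_ext b).
Proof. by case: d b => [|d] b; [case: b|rewrite /= OIext_comp]. Qed.

Lemma OIbasis_shift_map d m n (f : OIhom m n) (b : OIbasis (Some d) m) :
  OIbasis_shift (OIbasis_map f b) = OIbasis_map (OIext f) (OIbasis_shift b).
Proof. by rewrite /OIbasis_shift -!OIbasis_map_comp OIext_shift. Qed.

Lemma OIbasis_ext_shift d n (p : OIbasis (OIpred d) n) (p' : OIbasis (Some d) n) :
  OIbasis_ext p != OIbasis_shift p'.
Proof.
case: d p p' => [|d] p p'; first by case: p.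
apply/eqP => /(congr1 (fun f : OIhom _ _ => val f ord0)).
rewrite /OIbasis_ext OIext0 /OIbasis_shift OIcompE OIshiftE => /eqP.
by rewrite (negPf (neq_lift _ _)).
Qed.

Variant OIbasis_spec d n : OIbasis (Some d) n.+1 -> Prop :=
| OIbasisExt p : OIbasis_spec (OIbasis_ext p)
| OIbasisShift p : OIbasis_spec (OIbasis_shift p).

Lemma OIbasisP d n (b : OIbasis (Some d) n.+1) : OIbasis_spec b.
Proof.
have [[p ->]|bN] := EM (exists p, b = OIbasis_ext p); first by constructor.
have [p ->] : exists p, b = OIbasis_shift p; last by constructor.
apply: OIhom_shift => i; apply/eqP => bi; case: bN.
case: d b i bi => [|d] b i bi; first by case: i bi.
have [|g ->] := OIhom_ext (f := b); last by exists g.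
by rewrite -(OIhom_first bi).
Qed.

(** Both kinds of basis elements are natural with respect to [OIext], and their
    naturality squares are weak pullbacks. This is all that the construction of
    [Q'] and [Q''] uses, so that both are instances of [colon_module]. *)
Definition ext_cartesian d d' (j : forall n, OIbasis d' n -> OIbasis d n.+1) :=
  (forall m n (f : OIhom m n) b,
     j n (OIbasis_map f b) = OIbasis_map (OIext f) (j m b)) /\
  (forall m n (f : OIhom m n) a b, OIbasis_map (OIext f) a = j n b ->
     exists2 b', a = j m b' & OIbasis_map f b' = b).

Lemma OIbasis_ext_cartesian d : ext_cartesian (@OIbasis_ext d).
Proof.
split=> [m n f b|m n f a b]; first exact: OIbasis_ext_map.
case: (OIbasisP a) => p.
  by rewrite -OIbasis_ext_map => /OIbasis_ext_inj <-; exists p.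
by rewrite -OIbasis_shift_map => /esym/eqP; rewrite (negPf (OIbasis_ext_shift _ _)).
Qed.

Lemma OIbasis_shift_cartesian d : ext_cartesian (@OIbasis_shift d).
Proof.
split=> [m n f b|m n f a b]; first exact: OIbasis_shift_map.
case: (OIbasisP a) => p.
  by rewrite -OIbasis_ext_map => /eqP; rewrite (negPf (OIbasis_ext_shift _ _)).
by rewrite -OIbasis_shift_map => /OIbasis_shift_inj <-; exists p.
Qed.

(** * Exponents of monomials *)

Local Notation mon c n := ('X_{1..#|{: 'I_c * 'I_n}|}).

Section Exponents.
Variable c : nat.

Definition expo n (u : mon c n) (i : 'I_c) (j : 'I_n) : nat :=
  u (enum_rank (i, j)).

Definition mon_of n (F : 'I_c -> 'I_n -> nat) : mon c n :=
  [multinom F (enum_val k).1 (enum_val k).2 | k < #|{: 'I_c * 'I_n}|].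

Lemma expoE n (F : 'I_c -> 'I_n -> nat) i j : expo (mon_of F) i j = F i j.
Proof. by rewrite /expo mnmE enum_rankK. Qed.

Lemma expoP n (u v : mon c n) : (forall i j, expo u i j = expo v i j) -> u = v.
Proof.
move=> uv; apply/mnmP => k; have := uv (enum_val k).1 (enum_val k).2.
by rewrite /expo -surjective_pairing enum_valK.
Qed.

Lemma expo_leP n (u v : mon c n) :
  reflect (forall i j, (expo u i j <= expo v i j)%N) (u <= v)%MM.
Proof.
apply: (iffP mnm_lepP) => uv; first by move=> i j; apply: uv.
move=> k; have := uv (enum_val k).1 (enum_val k).2.
by rewrite /expo -surjective_pairing enum_valK.
Qed.

Lemma expoD n (u v : mon c n) i j :
  expo (u + v)%MM i j = (expo u i j + expo v i j)%N.
Proof. exact: mnmDE. Qed.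

Definition pullm m n (f : OIhom m n) (u : mon c n) : mon c m :=
  mon_of (fun i j => expo u i (val f j)).

(** The action of [OIPmap f] on exponents, see [OIPmapX]. *)
Definition pushm m n (f : OIhom m n) (u : mon c m) : mon c n :=
  mon_of (fun i j => \sum_(k | val f k == j) expo u i k)%N.

Lemma pullE m n (f : OIhom m n) u i j : expo (pullm f u) i j = expo u i (val f j).
Proof. exact: expoE. Qed.

Lemma pullK m n (f : OIhom m n) : cancel (pushm f) (pullm f).
Proof.
move=> u; apply: expoP => i j; rewrite pullE expoE (big_pred1 j) // => k.
by rewrite /= (inj_eq (@OIhom_inj _ _ f)).
Qed.

Lemma pull_id n (u : mon c n) : pullm (OIid n) u = u.
Proof. by apply: expoP => i j; rewrite pullE ffunE. Qed.

Lemma pull_comp m n p (g : OIhom n p) (f : OIhom m n) u :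
  pullm (OIcomp g f) u = pullm f (pullm g u).
Proof. by apply: expoP => i j; rewrite !pullE OIcompE. Qed.

Lemma pull_le m n (f : OIhom m n) u v : (u <= v)%MM -> (pullm f u <= pullm f v)%MM.
Proof. by move=> /expo_leP uv; apply/expo_leP => i j; rewrite !pullE. Qed.

(** Since [f] is injective, pushing and pulling exponents is a Galois
    connection; this lets divisibility of monomials be expressed through
    [pullm], which unlike [pushm] does not involve sums. *)
Lemma push_le m n (f : OIhom m n) u v : (pushm f u <= v)%MM = (u <= pullm f v)%MM.
Proof.
apply/idP/idP => [uv|/expo_leP uv]; first by rewrite -(pullK f u) pull_le.
apply/expo_leP => i j; rewrite expoE.
have [[k kj]|jN] := EM (exists k, val f k = j).
  rewrite (big_pred1 k) => [|l]; first by have := uv i k; rewrite pullE kj.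
  by rewrite /= -kj (inj_eq (@OIhom_inj _ _ f)).
by rewrite big1 // => k /eqP kj; case: jN; exists k.
Qed.

Lemma pull_push_le m n (f : OIhom m n) u : (pushm f (pullm f u) <= u)%MM.
Proof. by rewrite push_le lepm_refl. Qed.

Lemma mdeg_expo n (u : mon c n) : mdeg u = (\sum_i \sum_j expo u i j)%N.
Proof.
rewrite mdegE pair_bigA /= (reindex _ (onW_bij _ (@enum_rank_bij _))) /=.
by apply: eq_bigr => -[i j] _.
Qed.

Lemma mdeg_push m n (f : OIhom m n) (u : mon c m) : mdeg (pushm f u) = mdeg u.
Proof.
rewrite !mdeg_expo; apply: eq_bigr => i _.
under eq_bigr do rewrite expoE big_mkcond.
rewrite exchange_big; apply: eq_bigr => k _ /=.
by rewrite -big_mkcond /= (big_pred1 (val f k)).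
Qed.

Lemma mdeg_le n (u v : mon c n) : (u <= v)%MM -> (mdeg u <= mdeg v)%N.
Proof.
by move=> uv; rewrite -(submK uv) mdegD leq_addl.
Qed.

Lemma mdeg_pull m n (f : OIhom m n) (u : mon c n) : (mdeg (pullm f u) <= mdeg u)%N.
Proof. by rewrite -(mdeg_push f) mdeg_le ?pull_push_le. Qed.

Lemma le_mdeg_eq n (u v : mon c n) : (u <= v)%MM -> mdeg v = mdeg u -> v = u.
Proof.
move=> uv; rewrite -(submK uv) mdegD => /eqP.
by rewrite -[eqbRHS]add0n eqn_add2r mdeg_eq0 => /eqP->; rewrite add0m.
Qed.

(** The exponent of [x_1^e] times the shift of [x^u], see [consm_push]. *)
Definition consm n (e : 'I_c -> nat) (u : mon c n) : mon c n.+1 :=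
  mon_of (fun i j => if unlift ord0 j is Some k then expo u i k else e i).

Lemma consm0 n e (u : mon c n) i : expo (consm e u) i ord0 = e i.
Proof. by rewrite expoE unlift_none. Qed.

Lemma consmS n e (u : mon c n) i j : expo (consm e u) i (lift ord0 j) = expo u i j.
Proof. by rewrite expoE liftK. Qed.

Lemma pull_consm n e (u : mon c n) : pullm (OIshift n) (consm e u) = u.
Proof. by apply: expoP => i j; rewrite pullE OIshiftE consmS. Qed.

Lemma pull_ext_consm m n (f : OIhom m n) e (u : mon c n) :
  pullm (OIext f) (consm e u) = consm e (pullm f u).
Proof.
apply: expoP => i j; rewrite pullE.
case: (unliftP ord0 j) => [k ->|->]; first by rewrite OIextS !consmS pullE.
by rewrite OIext0 !consm0.
Qed.

Lemma consm_push n e (u : mon c n) :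
  consm e u = (consm e (mon_of (fun _ _ => 0%N)) + pushm (OIshift n) u)%MM.
Proof.
apply: expoP => i j; rewrite expoD [in X in (_ + X)%N]expoE.
case: (unliftP ord0 j) => [k ->|->].
  rewrite !consmS expoE add0n (big_pred1 k) // => l.
  by rewrite /= OIshiftE (inj_eq (@lift_inj _ _)).
rewrite !consm0 big1 ?addn0 // => l; rewrite OIshiftE => /eqP/esym/eqP.
by rewrite (negPf (neq_lift _ _)).
Qed.

Lemma consm_le n e (v : mon c n.+1) (u : mon c n) :
  (v <= consm e u)%MM = [forall i, (expo v i ord0 <= e i)%N] &&
                        (pullm (OIshift n) v <= u)%MM.
Proof.
apply/expo_leP/andP => [vu|[/forallP v0 /expo_leP vS] i j].
  split; first by apply/forallP => i; rewrite -(consm0 e u).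
  by apply/expo_leP => i j; rewrite pullE OIshiftE -(consmS e u).
case: (unliftP ord0 j) => [k ->|->]; rewrite ?consm0 // consmS.
by rewrite -OIshiftE -pullE.
Qed.

Lemma mdeg_consm n e (u : mon c n) :
  mdeg (consm e u) = (\sum_i e i + mdeg u)%N.
Proof.
rewrite !mdeg_expo -big_split; apply: eq_bigr => i _.
rewrite big_ord_recl consm0; congr addn; apply: eq_bigr => j _.
exact: consmS.
Qed.

End Exponents.

Section Variables.
Variables (K : fieldType) (c : nat).

Lemma OIPmapX m n (f : OIhom m n) (u : mon c m) :
  OIPmap (K := K) f 'X_[u] = 'X_[pushm f u].
Proof.
rewrite /OIPmap comp_mpolyX.
under eq_bigr do rewrite tnth_mktuple /OIvar.
rewrite mprodXnE; congr mpolyX; apply: expoP => i j.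
rewrite expoE {1}/expo mnm_sumE.
rewrite (reindex _ (onW_bij _ (@enum_rank_bij _))) /=.
transitivity (\sum_p ((p.1, val f p.2) == (i, j)) * expo u p.1 p.2)%N.
  apply: eq_bigr => p _; rewrite mulmnE mnm1E enum_rankK (inj_eq enum_rank_inj).
  by rewrite /expo -surjective_pairing.
rewrite -(pair_bigA _ (fun a b => ((a, val f b) == (i, j)) * expo u a b)%N) /=.
rewrite (bigD1 i) //= [X in (_ + X)%N]big1 ?addn0 => [|a /negPf ai]; last first.
  by rewrite big1 // => b _; rewrite xpair_eqE ai.
rewrite [RHS]big_mkcond; apply: eq_bigr => b _; rewrite xpair_eqE eqxx /=.
by case: eqP; rewrite ?mul1n ?mul0n.
Qed.

Lemma xpowE n (e : 'I_c -> nat) :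
  xpow K n e = 'X_[consm e (mon_of (fun _ _ => 0%N))].
Proof.
rewrite /xpow /OIvar mprodXnE; congr mpolyX; apply: expoP => i j.
rewrite {1}/expo mnm_sumE.
under eq_bigr do rewrite mulmnE mnm1E (inj_eq enum_rank_inj) xpair_eqE.
rewrite (bigD1 i) //= big1 ?addn0 => [|a /negPf->]; last by rewrite mul0n.
case: (unliftP ord0 j) => [k ->|->]; last by rewrite consm0 !eqxx mul1n.
by rewrite consmS expoE (negPf (neq_lift _ _)) andbF mul0n.
Qed.

End Variables.

(** * Submodules spanned by monomials *)

Section Spans.
Variables (K : fieldType) (c : nat) (d : option nat).
Implicit Types (n : nat).

Definition coef n (q : OIfree K c d n) (u : mon c n) (b : OIbasis d n) : K :=
  (q b : {mpoly K[_]})@_u.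

Lemma coefP n (q q' : OIfree K c d n) :
  (forall u b, coef q u b = coef q' u b) -> q = q'.
Proof. by move=> qq'; apply/ffunP => b; apply/mpolyP => u; apply: qq'. Qed.

Lemma coef0 n u b : coef (0 : OIfree K c d n) u b = 0.
Proof. by rewrite /coef ffunE mcoeff0. Qed.

Lemma coefD n (q q' : OIfree K c d n) u b :
  coef (q + q') u b = coef q u b + coef q' u b.
Proof. by rewrite /coef ffunE mcoeffD. Qed.

Lemma coefN n (q : OIfree K c d n) u b : coef (- q) u b = - coef q u b.
Proof. by rewrite /coef ffunE mcoeffN. Qed.

Lemma coef_sum n I (r : seq I) (P : pred I) (F : I -> OIfree K c d n) u b :
  coef (\sum_(i <- r | P i) F i) u b = \sum_(i <- r | P i) coef (F i) u b.
Proof.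
elim/big_rec2: _ => [|i x y _ <-]; first exact: coef0.
exact: coefD.
Qed.

Lemma coefZ n a (q : OIfree K c d n) u b :
  coef ((a%:MP : OIP K c n) *: q) u b = a * coef q u b.
Proof. by rewrite /coef ffunE [X in X@__]mul_mpolyC mcoeffZ. Qed.

Lemma coef_OImon n (v : mon c n) (b' : OIbasis d n) u b :
  coef (OImon K v b') u b = ((v == u) && (b == b'))%:R.
Proof.
rewrite /coef ffunE; case: eqP => _; rewrite ?andbT ?andbF ?mcoeff0 //.
exact: mcoeffX.
Qed.

Lemma OImon_inj n (u v : mon c n) (b b' : OIbasis d n) :
  OImon K u b = OImon K v b' -> u = v /\ b = b'.
Proof.
move=> /(congr1 (fun q => coef q u b)); rewrite !coef_OImon !eqxx => /esym/eqP.
by case: andP => [[/eqP-> /eqP->]|_] //; rewrite eq_sym oner_eq0.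
Qed.

Lemma OImonE n (q : OIfree K c d n) :
  q = \sum_b \sum_(u <- msupp (q b : {mpoly K[_]}))
        ((coef q u b)%:MP : OIP K c n) *: OImon K u b.
Proof.
apply: coefP => v b; rewrite coef_sum (bigD1 b) //= [X in _ + X]big1 ?addr0.
  rewrite coef_sum.
  under eq_bigr do rewrite coefZ coef_OImon eqxx andbT.
  have [vq|/memN_msupp_eq0 vq] := boolP (v \in msupp (q b : {mpoly K[_]})).
    rewrite (bigD1_seq v) ?msupp_uniq //= eqxx mulr1 big1 ?addr0 // => u /negPf->.
    by rewrite mulr0.
  rewrite /coef vq big1 // => u _; case: eqP => [->|]; last by rewrite mulr0.
  by rewrite vq mul0r.
move=> b' /negPf b'b; rewrite coef_sum big1 // => u _.
by rewrite coefZ coef_OImon [b == _]eq_sym b'b andbF mulr0.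
Qed.

(** An additive predicate that contains the terms of [q] contains [q]: all
    computations below are reduced to monomials with this principle. *)
Lemma OIfree_ind n (P : OIfree K c d n -> Prop) (q : OIfree K c d n) :
  P 0 -> (forall x y, P x -> P y -> P (x + y)) ->
  (forall a u b, coef q u b != 0 -> P ((a%:MP : OIP K c n) *: OImon K u b)) -> P q.
Proof.
move=> P0 PD PZ; rewrite [q]OImonE; elim/big_ind: _ => // b _.
rewrite big_seq_cond; elim/big_ind: _ => // u /andP[uq _].
by apply: PZ; rewrite /coef -mcoeff_msupp.
Qed.

Lemma scale_OImon n (w u : mon c n) (b : OIbasis d n) :
  ('X_[w] : OIP K c n) *: OImon K u b = OImon K (w + u)%MM b.
Proof.
apply/ffunP => b'; rewrite !ffunE; case: eqP => _; last exact: mulr0.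
by rewrite mpolyXD.
Qed.

Lemma OIfree_map_OImon m n (f : OIhom m n) (u : mon c m) (b : OIbasis d m) :
  OIfree_map f (OImon K u b) = OImon K (pushm f u) (OIbasis_map f b).
Proof. by rewrite OIfree_map_mon OIPmapX. Qed.

Lemma mem_le n (N : submodClosed (OIfree K c d n)) u v b :
  OImon K u b \in N -> (u <= v)%MM -> OImon K v b \in N.
Proof.
by move=> uN uv; rewrite -(submK uv) -scale_OImon; apply: (rpredZ (s := N)).
Qed.

Lemma mem_map (M : OIsubmod K c d) m n (f : OIhom m n) u b v :
  OImon K u b \in M m -> (u <= pullm f v)%MM ->
  OImon K v (OIbasis_map f b) \in M n.
Proof.
move=> uM; rewrite -push_le; apply: mem_le.
by rewrite -OIfree_map_OImon; apply: OIsub_map.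
Qed.

(** For a submodule this is the same as being generated by monomials. *)
Definition spanned n (N : submodClosed (OIfree K c d n)) :=
  forall q, q \in N -> forall u b, coef q u b != 0 -> OImon K u b \in N.

Lemma mem_coef n (N : submodClosed (OIfree K c d n)) q :
  (forall u b, coef q u b != 0 -> OImon K u b \in N) -> q \in N.
Proof.
move=> qN.
apply: (OIfree_ind (P := fun x => x \in N)) => [|x y xN yN|a u b /qN ubN].
- exact: rpred0.
- exact: rpredD.
- exact: (rpredZ (s := N)).
Qed.

Lemma spanned_eq n (N N' : submodClosed (OIfree K c d n)) :
  spanned N -> spanned N' ->
  (forall u b, OImon K u b \in N = (OImon K u b \in N')) -> N =i N'.
Proof.
move=> sN sN' NN' q; apply/idP/idP => qN; apply: mem_coef => u b qub.
  by rewrite -NN'; apply: sN qub.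
by rewrite NN'; apply: sN' qub.
Qed.

(** The sets of monomials that are closed under multiples and under the morphisms
    of OI. Divisibility is expressed on the side of the source, through [pullm],
    so that one condition covers both. *)
Definition OIclosed (I : forall n, mon c n -> OIbasis d n -> Prop) :=
  forall m n (f : OIhom m n) u b v,
    I m u b -> (u <= pullm f v)%MM -> I n v (OIbasis_map f b).

Lemma OIclosed_le I n (u v : mon c n) b :
  OIclosed I -> I n u b -> (u <= v)%MM -> I n v b.
Proof.
by move=> cI uI uv; rewrite -[b]OIbasis_map_id; apply: cI uI _; rewrite pull_id.
Qed.

End Spans.

Section MonomialSpan.
Variables (K : fieldType) (c : nat) (d : option nat) (n : nat).
Variable I : mon c n -> OIbasis d n -> Prop.
Hypothesis upI : forall u v b, I u b -> (u <= v)%MM -> I v b.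

Definition monspan_pred : {pred OIfree K c d n} :=
  fun q => `[< forall u b, coef q u b != 0 -> I u b >].

Fact monspan_closed : submod_closed monspan_pred.
Proof.
split=> [|a x y /asboolP xI /asboolP yI]; apply/asboolP => u b.
  by rewrite coef0 eqxx.
rewrite coefD => nz.
have [xn|/negP] := boolP (coef (a *: x) u b != 0); last first.
  by move=> /negP; rewrite negbK => /eqP x0; apply: yI; move: nz; rewrite x0 add0r.
have : u \in msupp ((a : {mpoly K[_]}) * (x b : {mpoly K[_]})).
  by rewrite mcoeff_msupp; move: xn; rewrite /coef ffunE.
move=> /msuppM_le/allpairsP[[v w] /= [_ wx ->]].
apply: (@upI w); last exact: lem_addl.
by apply: xI; rewrite /coef -mcoeff_msupp.
Qed.
HB.instance Definition _ := GRing.isSubmodClosed.Build (OIP K c n)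
  (OIfree K c d n) monspan_pred monspan_closed.

Definition monspan : submodClosed (OIfree K c d n) := monspan_pred.

Lemma mem_monspan u b : OImon K u b \in monspan <-> I u b.
Proof.
split=> [/asboolP uI|uI]; first by apply: uI; rewrite coef_OImon !eqxx oner_neq0.
apply/asboolP => v b'.
by rewrite coef_OImon; case: andP => [[/eqP<- /eqP->]|_] //; rewrite eqxx.
Qed.

Lemma spanned_monspan : spanned monspan.
Proof. by move=> q /asboolP qI u b /qI; rewrite mem_monspan. Qed.

End MonomialSpan.

Section OISpan.
Variables (K : fieldType) (c : nat) (d : option nat).
Variable I : forall n, mon c n -> OIbasis d n -> Prop.
Hypothesis closedI : OIclosed I.

Let spanI n :=
  monspan K (fun u v b => OIclosed_le closedI (n:=n) (u:=u) (v:=v) (b:=b)).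

Fact OIspan_map m n (f : OIhom m n) (q : OIfree K c d m) :
  q \in spanI m -> OIfree_map f q \in spanI n.
Proof.
move=> /asboolP qI; apply: (OIfree_ind (q := q)
    (P := fun x => OIfree_map f x \in spanI n)) => [|x y xI yI|a u b /qI ubI].
- have -> : OIfree_map f (0 : OIfree K c d m) = 0.
    by apply/ffunP => b; rewrite !ffunE big1 // => b' _; rewrite ffunE rmorph0.
  exact: rpred0.
- by rewrite OIfree_mapD rpredD.
- rewrite OIfree_mapZ; apply: (rpredZ (s := spanI n)).
  rewrite OIfree_map_OImon mem_monspan.
  by apply: closedI ubI _; rewrite pullK lepm_refl.
Qed.

Definition OIspan : OIsubmod K c d := MkOIsubmod OIspan_map.

Lemma mem_OIspan n u b : OImon K u b \in OIspan n <-> I u b.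
Proof. exact: mem_monspan. Qed.

Lemma spanned_OIspan n : spanned (OIspan n).
Proof. exact: spanned_monspan. Qed.

End OISpan.

(** * Generators of monomial OI-submodules *)

Section Divisibility.
Variables (c : nat) (d : option nat).

(** [x^v e_a] divides [x^u e_b] when some multiple of the image of the former
    under a morphism of OI is the latter. *)
Definition mdvd m n (v : mon c m) (a : OIbasis d m)
    (u : mon c n) (b : OIbasis d n) :=
  exists2 f : OIhom m n, OIbasis_map f a = b & (v <= pullm f u)%MM.

Lemma mdvd_refl n (u : mon c n) b : mdvd u b u b.
Proof. by exists (OIid n); rewrite ?OIbasis_map_id ?pull_id ?lepm_refl. Qed.

Lemma mdvd_trans m n p (u : mon c m) a (v : mon c n) b (w : mon c p) e :
  mdvd u a v b -> mdvd v b w e -> mdvd u a w e.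
Proof.
move=> [f fa uv] [g gb vw]; exists (OIcomp g f).
  by rewrite OIbasis_map_comp fa.
by rewrite pull_comp; apply: lepm_trans uv (pull_le _ vw).
Qed.

Lemma OIhom_addn m n (f : OIhom m n) (i j : 'I_m) (k : nat) :
  (i + k)%N = j -> (val f i + k <= val f j)%N.
Proof.
elim: k j => [|k IHk] j ij.
  by rewrite addn0; have -> : i = j by apply: val_inj; rewrite /= -ij addn0.
have ikm : (i + k < m)%N by move: (ltn_ord j); rewrite -ij; lia.
rewrite addnS; apply: leq_ltn_trans (IHk (Ordinal ikm) _) _ => //.
by rewrite OIhomE /= -ij addnS.
Qed.

(** A strictly increasing self-map can neither lower a point, as the points below
    it need room, nor raise it, as the points above it do. *)
Lemma OIhom_id n (f : OIhom n n) : f = OIid n.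
Proof.
apply: OIhom_eq => i; rewrite ffunE; apply: val_inj.
have n0 : (0 < n)%N by case: n i {f} => [[]|].
have n1 : (n.-1 < n)%N by rewrite prednK.
have := OIhom_addn f (add0n i : (Ordinal n0 + i)%N = i).
have := OIhom_addn (j := Ordinal n1) f (subnKC (_ : i <= n.-1)%N).
have := ltn_ord (val f (Ordinal n1)); have := ltn_ord i => /=.
by move=> iln fln /(_ ltac:(lia)); lia.
Qed.

Lemma mdvd_size m n (v : mon c m) a (u : mon c n) b :
  mdvd v a u b -> (m <= n)%N /\ (mdeg v <= mdeg u)%N.
Proof.
move=> [f _ vu]; split; first exact: OIhom_leq f.
exact: leq_trans (mdeg_le vu) (mdeg_pull f u).
Qed.

Lemma mdvd_eq n (v : mon c n) a (u : mon c n) b :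
  mdvd v a u b -> mdeg u = mdeg v -> u = v /\ b = a.
Proof.
move=> [f <-]; rewrite (OIhom_id f) pull_id OIbasis_map_id => vu uv.
by split=> //; apply: le_mdeg_eq.
Qed.

End Divisibility.

Section Generators.
Variables (K : fieldType) (c : nat) (d : option nat).
Implicit Types (M : OIsubmod K c d) (S : forall n, set (OIfree K c d n)).

Lemma mem_mdvd M m n (v : mon c m) a (u : mon c n) b :
  OImon K v a \in M m -> mdvd v a u b -> OImon K u b \in M n.
Proof. by move=> vM [f <-]; apply: mem_map. Qed.

Lemma OIgenerates_mdvd S M :
  (forall n q, S n q -> is_OImon q) -> OIgenerates S M ->
  (forall n, spanned (M n)) /\
  (forall n u b, OImon K u b \in M n ->
     exists k (v : mon c k) a, S k (OImon K v a) /\ mdvd v a u b).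
Proof.
move=> Smon [SM Mmin].
(* The span of all multiples of images of [S] is an OI-submodule containing [S]. *)
pose I n (u : mon c n) b :=
  exists k (v : mon c k) a, S k (OImon K v a) /\ mdvd v a u b.
have cI : OIclosed I.
  move=> m n f u b v [k [w [a [Sw wu]]]] uv; exists k, w, a; split=> //.
  by apply: mdvd_trans wu _; exists f.
have IM n u b : I n u b -> OImon K u b \in M n.
  by move=> [k [v [a [/SM vM vu]]]]; apply: mem_mdvd vM vu.
have MI n : {subset M n <= OIspan K cI n}.
  apply: Mmin => m q Sq; have [u [b qE]] := Smon _ _ Sq.
  rewrite qE mem_OIspan; exists m, u, b; rewrite -qE; split=> //.
  exact: mdvd_refl.
split=> [n q /MI qI u b /(spanned_OIspan qI)|n u b /MI]; rewrite mem_OIspan //.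
exact: IM.
Qed.

(** For submodules spanned by monomials, the divisibility criterion for being
    generated is also sufficient. *)
Lemma mdvd_OIgenerates S M :
  (forall n, spanned (M n)) -> (forall n q, S n q -> q \in M n) ->
  (forall n u b, OImon K u b \in M n ->
     exists k (v : mon c k) a, S k (OImon K v a) /\ mdvd v a u b) ->
  OIgenerates S M.
Proof.
move=> sM SM Sdvd; split=> // M' SM' n q qM.
apply: mem_coef => u b /(sM _ _ qM)/Sdvd[k [v [a [Sv vu]]]].
exact: mem_mdvd (SM' _ _ Sv) vu.
Qed.

Lemma OImonomial_spanned M : OImonomial M -> forall n, spanned (M n).
Proof. by move=> [S [Smon /(OIgenerates_mdvd Smon)[]]]. Qed.

Lemma spanned_OImonomial M : (forall n, spanned (M n)) -> OImonomial M.
Proof.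
move=> sM; exists (fun n q => is_OImon q /\ q \in M n); split=> [n q []//|].
apply: mdvd_OIgenerates => // [n q []//|n u b uM].
by exists n, u, b; split; [split=> //; exists u, b|apply: mdvd_refl].
Qed.

(** The monomials of [M] that are minimal for divisibility; since a proper
    divisor has a smaller width or a smaller degree, comparing the sum of both
    detects properness. *)
Definition irreducible M n (u : mon c n) b :=
  OImon K u b \in M n /\
  forall k (v : mon c k) a, OImon K v a \in M k -> mdvd v a u b ->
    (k + mdeg v = n + mdeg u)%N.

Lemma irreducible_mdvd M n u b : OImon K u b \in M n ->
  exists k (v : mon c k) a, irreducible M v a /\ mdvd v a u b.
Proof.
have [w] := ubnP (n + mdeg u); elim: w n u b => // w IHw n u b nuw uM.
have [uirr|] := EM (irreducible M u b).
  by exists n, u, b; split=> //; apply: mdvd_refl.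
move=> /not_andP[//|/existsNP[k /existsNP[v /existsNP[a]]]].
move=> /not_implyP[vM /not_implyP[vu /eqP vuN]].
have [kn vu'] := mdvd_size vu.
have [|l [s [e [sirr sv]]]] := IHw k v a _ vM; first by lia.
by exists l, s, e; split=> //; apply: mdvd_trans sv vu.
Qed.

(** An irreducible monomial has no divisor but itself among the generators, so it
    belongs to every monomial generating set: the irreducible monomials are the
    unique minimal one. *)
Lemma irreducible_gen S M n u b :
  (forall n q, S n q -> is_OImon q) -> OIgenerates S M ->
  irreducible M u b -> S n (OImon K u b).
Proof.
move=> Smon Sgen [uM uirr].
have [_ /(_ _ _ _ uM)[k [v [a [Sv vu]]]]] := OIgenerates_mdvd Smon Sgen.
have := uirr _ _ _ (Sgen.1 _ _ Sv) vu; have [kn vu'] := mdvd_size vu.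
move=> kvnu; have kE : k = n by lia.
move: v a Sv vu vu' kvnu; rewrite kE => v a Sv vu _ /addnI/esym uv.
by have [-> ->] := mdvd_eq vu uv.
Qed.

Lemma irreducible_min_mon_gens M : (forall n, spanned (M n)) ->
  OImin_mon_gens (fun n q => exists u b, q = OImon K u b /\ irreducible M u b) M.
Proof.
move=> sM; split=> [n q [u [b [-> _]]]||S' S'S S'gen n q [u [b [-> uirr]]]].
- by exists u, b.
- apply: mdvd_OIgenerates => // [n q [u [b [-> []]]] //|n u b].
  move=> /irreducible_mdvd[k [v [a [virr vu]]]]; exists k, v, a.
  by split=> //; exists v, a.
- apply: irreducible_gen S'gen uirr => m p /S'S[v [a [-> _]]].
  by exists v, a.
Qed.

(** The irreducible monomials are minimal generators, hence of width at most [w]. *)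
Lemma generated_mdvd M (w : int) :
  OImonomial M -> generated_in_width M w ->
  forall n u b, OImon K u b \in M n ->
  exists k (v : mon c k) a,
    [/\ (k%:Z <= w)%R, OImon K v a \in M k & mdvd v a u b].
Proof.
move=> /OImonomial_spanned sM Mw n u b.
move=> /irreducible_mdvd[k [v [a [virr vu]]]]; exists k, v, a; split=> //.
  apply: (Mw k (OImon K v a)); eexists; split.
    exact: irreducible_min_mon_gens sM.
  by exists v, a.
exact: virr.1.
Qed.

(** The generators of width at most [w] among a minimal set of generators are
    enough as soon as all monomials have a divisor of width at most [w]. *)
Lemma mdvd_generated M (w : int) :
  (forall n u b, OImon K u b \in M n ->
     exists k (v : mon c k) a,
       [/\ (k%:Z <= w)%R, OImon K v a \in M k & mdvd v a u b]) ->
  generated_in_width M w.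
Proof.
move=> Mw n q [S [[Smon Sgen Smin] Sq]].
have [sM Sdvd] := OIgenerates_mdvd Smon Sgen.
pose S' k (x : OIfree K c d k) := S k x /\ (k%:Z <= w)%R.
suff /Smin S'q : OIgenerates S' M by case: (S'q (fun _ _ => @proj1 _ _) n q Sq).
apply: mdvd_OIgenerates => // [k x [/Sgen.1 //]|k u b /Mw[l [v [a [lw vM vu]]]]].
have [p [s [e [Ss sv]]]] := Sdvd _ _ _ vM.
exists p, s, e; split; last exact: mdvd_trans sv vu.
by split=> //; have [] := mdvd_size sv; lia.
Qed.

End Generators.

(** * Generators in a fixed width *)

(** A subsequence picks again and again the first index of a minimal value
    among those not yet passed. *)
Lemma nondecreasing_subseq (f : nat -> nat) :
  exists s : nat -> nat,
    (forall i j, (i < j)%N -> (s i < s j)%N) /\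
    (forall i j, (i <= j)%N -> (f (s i) <= f (s j))%N).
Proof.
have minP N : exists n, (N <= n)%N /\ forall k, (N <= k)%N -> (f n <= f k)%N.
  have ex : exists v, `[< exists2 k, (N <= k)%N & f k = v >].
    by exists (f N); apply/asboolP; exists N.
  case: (ex_minnP ex) => v /asboolP[n Nn <-] vmin; exists n; split=> // k Nk.
  by apply: vmin; apply/asboolP; exists k.
have [g gP] := choice minP.
pose s := fix s i := if i is j.+1 then g (s j).+1 else g 0%N.
have sS i : (s i < s i.+1)%N by have [] := gP (s i).+1.
have sf i k : (s i <= k)%N -> (f (s i) <= f k)%N.
  case: i => [|i] sk; first by have [_ ->] := gP 0%N.
  by have [ig ->] := gP (s i).+1; rewrite // (leq_trans ig).
have s_mono i j : (i < j)%N -> (s i < s j)%N.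
  by apply: (homo_ltn ltn_trans) => k; apply: sS.
exists s; split=> // i j; rewrite leq_eqVlt => /predU1P[->//|/s_mono/ltnW].
exact: sf.
Qed.

Lemma dickson_subseq (T : eqType) (J : seq T) (f : nat -> T -> nat) :
  exists s : nat -> nat,
    (forall i j, (i < j)%N -> (s i < s j)%N) /\
    (forall x, x \in J -> forall i j, (i <= j)%N -> (f (s i) x <= f (s j) x)%N).
Proof.
elim: J => [|x J [s [s_mono sJ]]]; first by exists id.
have [t [t_mono tx]] := nondecreasing_subseq (fun i => f (s i) x).
exists (s \o t); split=> [i j /t_mono/s_mono //|y].
rewrite inE => /predU1P[->|yJ] i j; first exact: tx.
rewrite leq_eqVlt => /predU1P[->//|/t_mono/ltnW]; exact: sJ.
Qed.

(** Dickson's lemma, in the form that is needed: antichains of monomials have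
    bounded degree. *)
Lemma antichain_mdeg N (A : 'X_{1..N} -> Prop) :
  (forall u v, A u -> A v -> (u <= v)%MM -> u = v) ->
  exists B, forall u, A u -> (mdeg u <= B)%N.
Proof.
move=> Aanti; apply: contrapT => /forallNP Aunb.
have /choice[h hP] B : exists u, A u /\ (B < mdeg u)%N.
  have /existsNP[u /not_implyP[Au /negP]] := Aunb B.
  by rewrite -ltnNge; exists u.
(* A sequence in [A] of increasing degrees; Dickson's lemma compares two of its
   terms, which an antichain forbids. *)
pose f := fix f i := if i is j.+1 then h (mdeg (f j)) else h 0%N.
have fA i : A (f i) by case: i => [|i]; [case: (hP 0%N)|case: (hP (mdeg (f i)))].
have f_mono i j : (i < j)%N -> (mdeg (f i) < mdeg (f j))%N.
  apply: (homo_ltn (f := fun i => mdeg (f i)) ltn_trans) => k.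
  by case: (hP (mdeg (f k))).
have [s [s_mono sf]] := dickson_subseq (enum 'I_N) (fun i k => f i k).
have f01 : f (s 0%N) = f (s 1%N).
  by apply: Aanti => //; apply/mnm_lepP => k; apply: sf; rewrite ?mem_enum.
by have := f_mono _ _ (s_mono 0%N 1%N isT); rewrite f01 ltnn.
Qed.

Section FixedWidth.
Variables (K : fieldType) (c : nat) (d : option nat) (n : nat).
Implicit Types (T : submodClosed (OIfree K c d n)) (S : set (OIfree K c d n)).

Lemma generates_le S T :
  (forall q, S q -> is_OImon q) -> generates S T ->
  spanned T /\
  (forall u b, OImon K u b \in T ->
     exists2 v : mon c n, S (OImon K v b) & (v <= u)%MM).
Proof.
move=> Smon [ST Tmin].
pose I (u : mon c n) b := exists2 v : mon c n, S (OImon K v b) & (v <= u)%MM.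
have upI u v b : I u b -> (u <= v)%MM -> I v b.
  by move=> [w Sw wu] uv; exists w => //; apply: lepm_trans wu uv.
have TI : {subset T <= monspan K upI}.
  apply: Tmin => q Sq; have [u [b qE]] := Smon _ Sq.
  by rewrite qE mem_monspan; exists u; rewrite -?qE ?lepm_refl.
split=> [q /TI qI u b /(spanned_monspan qI)|u b /TI]; rewrite mem_monspan //.
by move=> [v /ST]; apply: mem_le.
Qed.

Lemma le_generates S T :
  spanned T -> (forall q, S q -> q \in T) ->
  (forall u b, OImon K u b \in T ->
     exists2 v : mon c n, S (OImon K v b) & (v <= u)%MM) ->
  generates S T.
Proof.
move=> sT ST Sle; split=> // T' ST' q qT.
apply: mem_coef => u b /(sT _ qT)/Sle[v Sv vu].
exact: mem_le (ST' _ Sv) vu.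
Qed.

Definition min_mon T (u : mon c n) b :=
  OImon K u b \in T /\
  forall v, OImon K v b \in T -> (v <= u)%MM -> v = u.

Lemma min_mon_le T u b : OImon K u b \in T ->
  exists2 v, min_mon T v b & (v <= u)%MM.
Proof.
have [w] := ubnP (mdeg u); elim: w u => // w IHw u uw uT.
have [umin|] := EM (min_mon T u b); first by exists u; rewrite ?lepm_refl.
move=> /not_andP[//|/existsNP[v /not_implyP[vT /not_implyP[vu vuN]]]].
have [|x xmin xv] := IHw v _ vT; last by exists x => //; apply: lepm_trans xv vu.
have := mdeg_le vu; rewrite leq_eqVlt => /predU1P[/esym/(le_mdeg_eq vu) uv|].
  by case: vuN.
by lia.
Qed.

(** In a minimal set of generators, those that are minimal for divisibility
    generate already, so there are no others. *)
Lemma min_mon_genP T u b : spanned T ->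
  min_mon_gen T (OImon K u b) <-> min_mon T u b.
Proof.
move=> sT; split=> [[S [[Smon Sgen Smin] Su]]|umin].
  have [_ Sle] := generates_le Smon Sgen.
  pose S' q := S q /\ exists v a, q = OImon K v a /\ min_mon T v a.
  suff S'gen : generates S' T.
    have S'S q : S' q -> S q by case.
    by have [_ [v [a [/OImon_inj[-> ->]]]]] := Smin S' S'S S'gen _ Su.
  apply: le_generates => // [q [/Sgen.1 //]|v a /min_mon_le[w [wT wmin] wv]].
  have [x Sx xw] := Sle _ _ wT.
  have xE := wmin _ (Sgen.1 _ Sx) xw; exists w => //.
  by split; [rewrite -xE|exists w, a].
exists (fun q => exists v a, q = OImon K v a /\ min_mon T v a).
split; last by exists u, b.
split=> [q [v [a [-> _]]]||S' S'S S'gen _ [v [a [-> [vT vmin]]]]].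
- by exists v, a.
- apply: le_generates => // [_ [v [a [-> []]]] //|v a /min_mon_le[w wmin wv]].
  by exists w => //; exists w, a.
- have [|_ /(_ _ _ vT)[w S'w wv]] := generates_le _ S'gen.
    by move=> q /S'S[w [e [-> _]]]; exists w, e.
  by rewrite -(vmin w) // S'gen.1.
Qed.

Lemma min_mon_bounded T : exists B, forall u b, min_mon T u b -> (mdeg u <= B)%N.
Proof.
have /choice[B BP] b : exists B, forall u, min_mon T u b -> (mdeg u <= B)%N.
  by apply: antichain_mdeg => u v [uT _] [_ vmin]; apply: vmin.
exists (\max_b B b) => u b /BP uB; exact: leq_trans uB (leq_bigmax b).
Qed.

Lemma is_max_gen_degP T k : spanned T -> is_max_gen_deg T k <->
  (exists u b, min_mon T u b /\ mdeg u = k) /\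
  (forall u b, min_mon T u b -> (mdeg u <= k)%N).
Proof.
move=> sT; split=> -[[u [b [umin uk]]] kmax].
  split; first by exists u, b; rewrite -min_mon_genP.
  by move=> v a /min_mon_genP-/(_ sT)/kmax.
split; first by exists u, b; rewrite min_mon_genP.
by move=> v a /min_mon_genP-/(_ sT)/kmax.
Qed.

Variant eplus_spec T : option nat -> Prop :=
| EplusNone of (forall u b, OImon K u b \notin T) : eplus_spec T None
| EplusSome k u b of min_mon T u b & mdeg u = k
    & (forall v a, min_mon T v a -> (mdeg v <= k)%N) : eplus_spec T (Some k).

(** The minimal monomials have bounded degree by Dickson's lemma, so that the
    default value in the definition of [eplus] is never reached. *)
Lemma eplusP T : spanned T -> eplus_spec T (eplus T).
Proof.
move=> sT; rewrite /eplus; case: asboolP => [T0|TN].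
  constructor=> u b; apply/negP => /T0/(congr1 (fun q => coef q u b))/eqP.
  by rewrite coef_OImon coef0 !eqxx oner_eq0.
have [u [b uT]] : exists u b, OImon K u b \in T.
  apply: contrapT => TN'; apply: TN => q qT; apply: coefP => u b.
  rewrite coef0; apply/eqP; apply: contrapT => /negP qub; case: TN'.
  by exists u, b; apply: sT qub.
have [v vmin _] := min_mon_le uT.
have ex : exists k, `[< exists u b, min_mon T u b /\ mdeg u = k >].
  by exists (mdeg v); apply/asboolP; exists v, b.
have [B BP] := min_mon_bounded T.
have [|k /asboolP[x [a [xmin xk]]] kmax] := @ex_maxnP _ B ex.
  by move=> k /asboolP[x [a [/BP xB <-]]].
have kP : is_max_gen_deg T k.
  apply/is_max_gen_degP => //; split; first by exists x, a.
  by move=> y e ymin; apply: kmax; apply/asboolP; exists y, e.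
have /is_max_gen_degP-/(_ sT)[[y [e [ymin yE]]] ymax] :=
  xgetPex 0%N (ex_intro _ _ kP).
exact: EplusSome ymin yE ymax.
Qed.

End FixedWidth.

(** * Hilbert functions *)

Lemma modquot_pi_sum (R : comNzRingType) (V : lmodType R) (N : submodClosed V)
    I (r : seq I) (P : pred I) (F : I -> V) :
  modquot_pi N (\sum_(i <- r | P i) F i) = \sum_(i <- r | P i) modquot_pi N (F i).
Proof.
elim/big_rec2: _ => [|i x y _ <-]; last by rewrite modquot_piD.
by apply: (addrI (modquot_pi N 0)); rewrite -modquot_piD !addr0.
Qed.

Lemma modquot_piZ (R : comNzRingType) (V : lmodType R) (N : submodClosed V)
    (a : R) (v : V) : modquot_pi N (a *: v) = a *: modquot_pi N v.
Proof. exact/esym/modquot_scale_pi. Qed.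

Lemma modquot_pi_eq0 (R : comNzRingType) (V : lmodType R) (N : submodClosed V)
    (v : V) : modquot_pi N v = 0 <-> v \in N.
Proof.
have pi0 : modquot_pi N 0 = 0.
  by have := modquot_pi_sum N [::] predT id; rewrite !big_nil.
by rewrite -pi0 -[X in X \in N]subr0; apply: modquot_eqP.
Qed.

Section Dimension.
Variables (K : fieldType) (V : lmodType K) (W : set V).

Lemma is_dim_le r r' : is_dim W r -> is_dim W r' -> (r <= r')%N.
Proof.
move=> [b [bW bfree _]] [b' [_ _ b'gen]].
have /choice[A AE] i : exists a : 'I_r' -> K, b i = \sum_j a j *: b' j.
  exact: b'gen.
suff /eqP<- : row_free (\matrix_(i, j) A i j) by exact: rank_leq_col.
apply: inj_row_free => v vA; apply/rowP => i; rewrite mxE.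
apply: (bfree (v 0)).
under eq_bigr do rewrite AE scaler_sumr.
rewrite exchange_big big1 // => j _.
under eq_bigr do rewrite scalerA.
rewrite -scaler_suml; have := congr1 (fun w : 'rV_r' => w 0 j) vA; rewrite !mxE.
by under eq_bigr do rewrite mxE; move=> ->; rewrite scale0r.
Qed.

Lemma dim_eq r : is_dim W r -> Defs.dim W = r.
Proof.
move=> Wr; have W' := xgetPex 0%N (ex_intro _ _ Wr).
by apply/eqP; rewrite eqn_leq !is_dim_le.
Qed.

End Dimension.

Section Hilbert.
Variables (K : fieldType) (c : nat) (d : option nat) (n : nat).
Implicit Types (T : submodClosed (OIfree K c d n)) (k : nat).

(** The standard monomials form a basis of the degree [k] component of the quotient
    by [T], see [hilbE]. *)
Definition standard T k : {set 'X_{1..#|{: 'I_c * 'I_n}| < k.+1} * OIbasis d n} :=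
  [set p : 'X_{1..#|{: 'I_c * 'I_n}| < k.+1} * OIbasis d n |
    (mdeg p.1 == k) && (OImon K p.1 p.2 \notin T)].

Lemma standardP T k (u : mon c n) b : mdeg u = k -> OImon K u b \notin T ->
  exists2 p, p \in standard T k & p.1 = u :> mon c n /\ p.2 = b.
Proof.
move=> uk uT; have uk1 : (mdeg u < k.+1)%N by rewrite uk.
by exists (BMultinom uk1, b); rewrite ?inE /= ?uk ?eqxx.
Qed.

Lemma hilbE T k : spanned T -> hilb T k = #|standard T k|.
Proof.
move=> sT; apply: dim_eq.
pose p (i : 'I_#|standard T k|) := enum_val i.
pose x i : OIfree K c d n := OImon K (p i).1 (p i).2.
have pP i : mdeg (p i).1 = k /\ x i \notin T.
  have := enum_valP i; rewrite inE => /andP[/eqP pk px].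
  by split; [exact: pk|exact: px].
have coef_x i j : coef (x i) (p j).1 (p j).2 = (i == j)%:R.
  rewrite coef_OImon; congr ((nat_of_bool _)%:R); rewrite -(inj_eq enum_val_inj).
  rewrite /p; case: (enum_val i) (enum_val j) => [v a] [w e] /=.
  by rewrite xpair_eqE [a == e]eq_sym.
have coef_sum_x (a : 'I_#|standard T k| -> K) i :
    coef (\sum_j ((a j)%:MP : OIP K c n) *: x j) (p i).1 (p i).2 = a i.
  rewrite coef_sum (bigD1 i) //= [X in _ + X]big1 => [|j /negPf ji].
    by rewrite coefZ coef_x eqxx mulr1 addr0.
  by rewrite coefZ coef_x ji mulr0.
have sumE (a : 'I_#|standard T k| -> K) :
    \sum_i a i *: (modquot_pi T (x i) :
                     restr (@mpolyC #|{: 'I_c * 'I_n}| K) (modquot T)) =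
    modquot_pi T (\sum_i ((a i)%:MP : OIP K c n) *: x i).
  rewrite modquot_pi_sum; apply: eq_bigr => i _.
  by rewrite modquot_piZ.
exists (fun i => modquot_pi T (x i)); split.
- move=> i; exists (x i); split=> // b; rewrite ffunE.
  case: eqP => _; last exact: rpred0.
  by rewrite dhomogX /= (pP i).1.
- move=> a; rewrite sumE => /modquot_pi_eq0 aT i.
  apply/eqP; apply: contrapT => /negP ai.
  have [_ /negP[]] := pP i; apply: (sT _ aT).
  by rewrite coef_sum_x.
move=> _ [q [qk ->]]; exists (fun i => coef q (p i).1 (p i).2).
rewrite sumE; apply/modquot_eqP; apply: mem_coef => u b.
rewrite coefD coefN.
have [uT //|uT] := boolP (OImon K u b \in T).
have [uk|uk] := eqVneq (mdeg u) k.
  have [r rP [ru rb]] := standardP uk uT.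
  have [i pi] : exists i, p i = r.
    by exists (enum_rank_in rP r); rewrite /p enum_rankK_in.
  by rewrite -ru -rb -pi coef_sum_x subrr eqxx.
have -> : coef q u b = 0 by apply: dhomog_nemf_coeff (qk b) _.
rewrite coef_sum big1 ?subrr ?eqxx // => i _; rewrite coefZ coef_OImon.
have /negPf-> : ((p i).1 : mon c n) != u.
  by apply: contraNneq uk => <-; rewrite (pP i).1.
by rewrite mulr0.
Qed.

Lemma standardS T T' k : {subset T <= T'} -> standard T' k \subset standard T k.
Proof.
move=> TT'; apply/fintype.subsetP => p; rewrite !inE => /andP[-> /=].
by apply: contra; apply: TT'.
Qed.

Lemma hilb_le T T' k : spanned T -> spanned T' -> {subset T <= T'} ->
  (hilb T' k <= hilb T k)%N.
Proof. by move=> sT sT' TT'; rewrite !hilbE // subset_leq_card // standardS. Qed.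

(** Equal dimensions force the inclusion of sets of standard monomials to be an
    equality. *)
Lemma hilb_eq T T' (u : mon c n) b : spanned T -> spanned T' -> {subset T <= T'} ->
  hilb T (mdeg u) = hilb T' (mdeg u) ->
  OImon K u b \in T' -> OImon K u b \in T.
Proof.
move=> sT sT' TT'; rewrite !hilbE // => TT'k.
have /eqP stdE : standard T' (mdeg u) == standard T (mdeg u).
  by rewrite eqEcard standardS //= TT'k.
move=> uT'; apply: contraLR uT' => /(standardP erefl)[p].
by rewrite -stdE inE => /andP[_ pT'] [pu pb]; rewrite -pb -[X in OImon K X]pu.
Qed.

(** The sums are compared term by term over degrees up to [e^+(T)]. Equality
    forces [T] and [T'] to agree in these degrees, in which [T'] is generated. *)
Lemma hilb_sum_le T T' : spanned T -> spanned T' -> {subset T <= T'} ->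
  (forall u b, min_mon T' u b ->
     exists v a, min_mon T v a /\ (mdeg u <= mdeg v)%N) ->
  (hilb_sum T' <= hilb_sum T)%N /\ (hilb_sum T = hilb_sum T' <-> T =i T').
Proof.
move=> sT sT' TT' T'T; rewrite /hilb_sum.
have T'_le := hilb_le _ sT sT' TT'.
case: (eplusP sT') => [T'0|k' u b umin uk' T'k'].
  have T0 v a : OImon K v a \notin T by apply: contra (T'0 v a); apply: TT'.
  have TE : T =i T'.
    by apply: spanned_eq => // v a; rewrite (negPf (T0 _ _)) (negPf (T'0 _ _)).
  case: (eplusP sT) => [_|k v a [vT]]; last by rewrite (negPf (T0 _ _)) in vT.
  by split.
have [v [a [vmin uv]]] := T'T _ _ umin.
case: (eplusP sT) => [T0|k w e wmin wk Tk].
  by case: vmin => vT; rewrite (negPf (T0 _ _)) in vT.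
have kk' : (k' <= k)%N by rewrite -uk'; apply: leq_trans uv (Tk _ _ vmin).
have sumT' : (\sum_(0 <= i < k'.+1) hilb T' i <= \sum_(0 <= i < k.+1) hilb T' i)%N.
  by rewrite [leqRHS](big_cat_nat _ (n := k'.+1)) //= leq_addr.
have sumT : (\sum_(0 <= i < k.+1) hilb T' i <= \sum_(0 <= i < k.+1) hilb T i)%N.
  exact: leq_sum.
split; first exact: leq_trans sumT.
split=> [TT'E|TE].
  have sumE : (\sum_(0 <= i < k.+1) hilb T' i =
               \sum_(0 <= i < k.+1) hilb T i)%N.
    by apply/eqP; rewrite eqn_leq sumT TT'E.
  have hE i : (i < k.+1)%N -> hilb T i = hilb T' i.
    move=> ik; apply/eqP; rewrite eqn_leq T'_le andbT leqNgt; apply/negP => lt.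
    move: sumE; rewrite !big_mkord (bigD1 (Ordinal ik)) //=.
    rewrite [RHS](bigD1 (Ordinal ik)) //=.
    have : (\sum_(j < k.+1 | j != Ordinal ik) hilb T' j <=
            \sum_(j < k.+1 | j != Ordinal ik) hilb T j)%N by exact: leq_sum.
    by move: lt; set x := bigop _ _ _; set y := bigop _ _ _; lia.
  apply: spanned_eq => // x y; apply/idP/idP; first exact: TT'.
  move=> /min_mon_le[z [zT' zmin] zx].
  have zk : (mdeg z < k.+1)%N by apply: leq_ltn_trans (T'k' _ _ (conj zT' zmin)) _.
  exact: mem_le (hilb_eq sT sT' TT' (hE _ zk) zT') zx.
have hE i : hilb T i = hilb T' i.
  rewrite !hilbE //; apply: eq_card => p; rewrite !inE.
  by rewrite TE.
have -> : k = k'.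
  apply/eqP; rewrite eqn_leq kk' andbT -wk; apply: (T'k' w e).
  case: wmin => wT wmin; split; first by rewrite -TE.
  by move=> x; rewrite -TE; apply: wmin.
by apply: eq_bigr => i _.
Qed.

End Hilbert.

(** * The colon modules *)

Section Colon.
Variables (K : fieldType) (c d m : nat) (M : OIsubmod K c (Some d)).
Hypothesis sM : forall n, spanned (M n).
Hypothesis Mgen : forall n (u : mon c n) b, OImon K u b \in M n ->
  exists k (v : mon c k) a, [/\ (k <= m)%N, OImon K v a \in M k & mdvd v a u b].
Variable e : 'I_c -> nat.

Lemma consm_mono n (u v : mon c n) : (u <= v)%MM -> (consm e u <= consm e v)%MM.
Proof.
move=> uv; rewrite consm_le pull_consm uv andbT.
by apply/forallP => i; rewrite consm0.
Qed.

Section ColonModule.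
Variables (d' : option nat) (j : forall n, OIbasis d' n -> OIbasis (Some d) n.+1).
Hypothesis jP : ext_cartesian j.

(** Membership in [M : x_1^e], transported from width [n.+1] to width [n] by
    deleting the first column. The cutoff [w] serves to make [Q''] vanish in
    width [m - 1]. *)
Definition colon_mon (w : nat) n (u : mon c n) (b : OIbasis d' n) : Prop :=
  (w <= n)%N /\ OImon K (consm e u) (j b) \in M n.+1.

Lemma colon_mon_closed w : OIclosed (colon_mon w).
Proof.
move=> k n f u b v [wk ubM] uv; split; first exact: leq_trans wk (OIhom_leq f).
case: jP => [-> _]; apply: mem_map ubM _.
by rewrite pull_ext_consm consm_mono.
Qed.

(** The generator of [M] that divides the monomial uses few points; if a point
    other than the first one is free, it can be deleted. What remains divides
    [x^u e_b] and satisfies the same condition in a smaller width. *)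
Lemma colon_mon_descent n (u : mon c n.+1) b :
  OImon K (consm e u) (j b) \in M n.+2 ->
  (forall k (a : OIbasis (Some d) k) (f : OIhom k n.+2), (k <= m)%N ->
     OIbasis_map f a = j b ->
     (k <= n.+1)%N /\ ((exists i, val f i = ord0) \/ (k <= n)%N)) ->
  exists (g : OIhom n n.+1) b',
    OImon K (consm e (pullm g u)) (j b') \in M n.+1 /\ OIbasis_map g b' = b.
Proof.
move=> /Mgen[k [v [a [km vM [f fa vu]]]]] /(_ _ _ _ km fa)[kn fk].
have [g [h fE]] := OIhom_factor kn fk; case: jP => [_ jinv].
have [|b' hE gb] := jinv _ _ g (OIbasis_map h a) b.
  by rewrite -OIbasis_map_comp -fE.
exists g, b'; split=> //; rewrite -hE; apply: mem_map vM _.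
by rewrite -pull_ext_consm -pull_comp -fE.
Qed.

Definition colon_module (w : nat) : OIsubmod K c d' :=
  OIspan K (@colon_mon_closed w).

Lemma mem_colon_module w n (u : mon c n) b :
  OImon K u b \in colon_module w n <->
  (w <= n)%N /\ OImon K (consm e u) (j b) \in M n.+1.
Proof. exact: mem_OIspan. Qed.

Lemma spanned_colon_module w n : spanned (colon_module w n).
Proof. exact: spanned_OIspan. Qed.

End ColonModule.

(** [colon_ext] is [Q'] and [colon_shift] is [Q'']. *)
Definition colon_ext := colon_module (@OIbasis_ext_cartesian d) 0.
Definition colon_shift := colon_module (@OIbasis_shift_cartesian d) m.

Lemma OIbasis_ext_first d1 k n (f : OIhom k n.+1) (a : OIbasis (Some d1) k) p :
  OIbasis_map f a = OIbasis_ext p -> exists i, val f i = ord0.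
Proof.
case: d1 a p => [|d1] a p; first by case: p.
move=> /(congr1 (fun g : OIhom _ _ => val g ord0)).
by rewrite /OIbasis_ext OIext0 OIcompE => fa; exists (val a ord0).
Qed.

Lemma colon_ext_generated : generated_in_width colon_ext (m%:Z - 1).
Proof.
apply: mdvd_generated => n; elim: n => [|n IHn] u b uQ.
  (* If [m = 0], the generator has width zero, and no map from the empty set hits
     the first point. *)
  have [m0|m0] := ltnP 0 m.
    by exists 0%N, u, b; split; [lia|done|apply: mdvd_refl].
  move: (uQ) => /mem_colon_module[_ /Mgen[k [v [a [km _ [f fa _]]]]]].
  have [i _] := OIbasis_ext_first fa.
  case: k i {v a f fa} km => [|k] i; first by case: i.
  by rewrite leqNgt ltnS (leq_trans m0).
have [nm|mn] := ltnP n.+1 m.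
  by exists n.+1, u, b; split; [lia|done|apply: mdvd_refl].
move: (uQ) => /mem_colon_module[_].
case/(colon_mon_descent (@OIbasis_ext_cartesian d)).
  move=> k a f km /OIbasis_ext_first fi.
  by split; [apply: leq_trans mn|left].
move=> g [b' [uM gb]].
have [|k [v [a [km vQ vu]]]] := IHn (pullm g u) b'; first exact/mem_colon_module.
exists k, v, a; split=> //; apply: mdvd_trans vu _.
by exists g; rewrite ?lepm_refl.
Qed.

Lemma colon_shift_generated : generated_in_width colon_shift m%:Z.
Proof.
apply: mdvd_generated => n; elim: n => [|n IHn] u b uQ.
  by exists 0%N, u, b; split; [lia|done|apply: mdvd_refl].
have [nm|mn] := leqP n.+1 m.
  by exists n.+1, u, b; split; [lia|done|apply: mdvd_refl].
move: (uQ) => /mem_colon_module[_].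
case/(colon_mon_descent (@OIbasis_shift_cartesian d)) => [k a f km _|].
  by split; [apply: leq_trans km (ltnW _)|right; apply: leq_trans km _].
move=> g [b' [uM gb]].
have [|k [v [a [km vQ vu]]]] := IHn (pullm g u) b'; first exact/mem_colon_module.
exists k, v, a; split=> //; apply: mdvd_trans vu _.
by exists g; rewrite ?lepm_refl.
Qed.

Lemma colon_shift_eq0 n q : (n < m)%N -> q \in colon_shift n -> q = 0.
Proof.
move=> nm qQ; apply: coefP => u b; rewrite coef0.
apply/eqP; apply: contrapT => /negP.
by move=> /(spanned_colon_module qQ)/mem_colon_module[]; rewrite leqNgt nm.
Qed.

Lemma sub_colon_shift : {subset M m <= colon_shift m}.
Proof.
move=> q qM; apply: mem_coef => u b /(sM qM) uM.
apply/mem_colon_module; split=> //; apply: mem_map uM _.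
by rewrite pull_consm lepm_refl.
Qed.

(** A minimal monomial that is divisible by the image of some monomial is itself
    the image of a minimal monomial, namely of its pullback. *)
Lemma min_mon_pull p n (g : OIhom p n) (x : mon c p) a (w : mon c n) :
  OImon K x a \in M p -> (x <= pullm g w)%MM ->
  min_mon (M n) w (OIbasis_map g a) ->
  min_mon (M p) (pullm g w) a /\ mdeg (pullm g w) = mdeg w.
Proof.
move=> xM xw [wM wmin].
have push_min y : OImon K y a \in M p -> (y <= pullm g w)%MM -> pushm g y = w.
  move=> yM yw; apply: wmin; last by rewrite push_le.
  by apply: mem_map yM _; rewrite pullK lepm_refl.
have wE := push_min _ (mem_le xM xw) (lepm_refl _).
split; last by rewrite -{2}wE mdeg_push.
split=> [|y yM yw]; first exact: mem_le xM xw.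
by rewrite -(push_min y) // pullK.
Qed.

(** A minimal monomial [x^u e_b] of [Q''_m] comes from a minimal generator of
    [M_(m+1)] that divides the shift of [x^u e_b] times [x_1^e]; as [M] is
    generated in width at most [m], this generator is the image of a minimal
    generator of [M_m] of the same degree. *)
Lemma colon_shift_min_mon u b : min_mon (colon_shift m) u b ->
  exists v a, min_mon (M m) v a /\ (mdeg u <= mdeg v)%N.
Proof.
move=> [/mem_colon_module[_ uM] umin].
have [w wmin] := min_mon_le uM; have [wM _] := wmin.
rewrite consm_le => /andP[w0 wu].
have <- : pullm (OIshift m) w = u.
  apply: umin => //; apply/mem_colon_module; split=> //; apply: mem_le wM _.
  by rewrite consm_le w0 lepm_refl.
have [k [v [a [km vM [f fa vw]]]]] := Mgen wM.
have [g [h fE]] := OIhom_factor1 f km; rewrite fE in fa vw.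
have hM : OImon K (pullm g w) (OIbasis_map h a) \in M m.
  by apply: mem_map vM _; rewrite -pull_comp.
have [] := min_mon_pull hM (lepm_refl _) (w := w).
  by rewrite -OIbasis_map_comp fa.
move=> gmin gw; exists (pullm g w), (OIbasis_map h a); split=> //.
by rewrite gw mdeg_pull.
Qed.

End Colon.

(** In widths at least [m], a monomial OI-submodule generated in width [m] is
    determined by its component of width [m]. *)
Lemma eq_from_width (K : fieldType) (c : nat) (d : option nat)
    (M M' : OIsubmod K c d) m n :
  (forall n, spanned (M n)) -> (forall n, spanned (M' n)) ->
  OImonomial M -> generated_in_width M m%:Z ->
  OImonomial M' -> generated_in_width M' m%:Z ->
  M m =i M' m -> (m <= n)%N -> M n =i M' n.
Proof.
have sub (N N' : OIsubmod K c d) : OImonomial N -> generated_in_width N m%:Z ->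
    N m =i N' m -> (m <= n)%N ->
    forall u b, OImon K u b \in N n -> OImon K u b \in N' n.
  move=> monN genN NN' mn u b.
  move=> /(generated_mdvd monN genN)[k [v [a [km vN [f <- vu]]]]].
  have [g [h fE]] := OIhom_through f km mn; rewrite fE OIbasis_map_comp.
  apply: (mem_map (u := pushm h v)); last by rewrite push_le -pull_comp -fE.
  by rewrite -OIfree_map_OImon -NN'; apply: OIsub_map.
move=> sM sM' monM genM monM' genM' MM' mn; apply: spanned_eq => // u b.
apply/idP/idP; first exact: sub.
by apply: sub => // q; rewrite MM'.
Qed.

(** * Setting the variables of the first column to zero *)

(** First isomorphism theorem, for a map that is semilinear along [f]. *)
Lemma first_isomorphism (R S : comNzRingType) (f : {rmorphism R -> S})
    (V : lmodType S) (N : submodClosed V) (W : lmodType R) (h : V -> W) :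
  {morph h : x y / x + y} -> (forall a v, h (f a *: v) = a *: h v) ->
  (forall v, h v = 0 <-> v \in N) -> (forall w, exists v, h v = w) ->
  exists phi : {linear restr f (modquot N) -> W},
    bijective phi /\ forall v, phi (modquot_pi N v) = h v.
Proof.
move=> hD hZ hN hsurj.
have h0 : h 0 = 0 by apply/hN/rpred0.
have hB u v : h (u - v) = h u - h v.
  by apply: (addIr (h v)); rewrite subrK -hD subrK.
have heq u v : modquot_pi N u = modquot_pi N v <-> h u = h v.
  rewrite modquot_eqP -hN hB; split=> [/eqP|->]; last by rewrite subrr.
  by rewrite subr_eq0 => /eqP.
pose phi (x : restr f (modquot N)) : W := h (repr (x : Quotient.quot (zmodset N))).
have phiE v : phi (modquot_pi N v) = h v by apply/heq; apply: modquot_reprK.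
have phi_lin : linear phi.
  move=> a x y; rewrite -[x]modquot_reprK -[y]modquot_reprK.
  rewrite -[a *: _]/(f a *: (modquot_pi N _)) -modquot_piZ -modquot_piD !phiE.
  by rewrite hD hZ.
pose phiL : {linear restr f (modquot N) -> W} :=
  HB.pack phi (GRing.isLinear.Build _ _ _ _ phi phi_lin).
exists phiL; split=> //.
have /choice[g gK] w : exists v, h v = w by apply: hsurj.
exists (fun w => modquot_pi N (g w)) => [x|w]; last by rewrite /= phiE gK.
by rewrite -[RHS](modquot_reprK (N := N)); apply/heq; rewrite gK.
Qed.

Section Unshift.
Variables (K : fieldType) (c n : nat).

Definition unshift_vars :
    #|{: 'I_c * 'I_n.+1}|.-tuple {mpoly K[#|{: 'I_c * 'I_n}|]} :=
  [tuple if unlift ord0 (enum_val k).2 is Some j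
         then OIvar K (enum_val k).1 j else 0
  | k < #|{: 'I_c * 'I_n.+1}|].

(** The projection of [P_(n+1)] onto [P_(n+1) / x_1 P_(n+1)], identified with
    [P_n]. *)
Definition unshift : OIP K c n.+1 -> OIP K c n := comp_mpoly unshift_vars.
HB.instance Definition _ := GRing.RMorphism.copy unshift (comp_mpoly unshift_vars).

Definition zero_exp : 'I_c -> nat := fun=> 0%N.

Lemma unshiftD : {morph unshift : p q / p + q}.
Proof. exact: (raddfD unshift). Qed.

Lemma unshiftM : {morph unshift : p q / p * q}.
Proof. exact: (rmorphM unshift). Qed.

Lemma unshift_sum I (r : seq I) (P : pred I) (F : I -> OIP K c n.+1) :
  unshift (\sum_(i <- r | P i) F i) = \sum_(i <- r | P i) unshift (F i).
Proof. exact: (raddf_sum unshift). Qed.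

Lemma unshift_var i : unshift (OIvar K i ord0) = 0.
Proof.
rewrite /unshift comp_mpolyXU -tnth_nth tnth_mktuple enum_rankK.
by rewrite unlift_none.
Qed.

Lemma unshift_varS i j : unshift (OIvar K i (lift ord0 j)) = OIvar K i j.
Proof.
by rewrite /unshift comp_mpolyXU -tnth_nth tnth_mktuple enum_rankK liftK.
Qed.

Lemma consm_zero (u : mon c n) : consm zero_exp u = pushm (OIshift n) u.
Proof.
rewrite consm_push -[RHS]add0m; congr (_ + _)%MM; apply: expoP => i j.
rewrite [RHS]mnm0E; case: (unliftP ord0 j) => [k ->|->]; rewrite ?consm0 // consmS.
exact: expoE.
Qed.

Lemma consm_zeroP (v : mon c n.+1) :
  (exists i, (0 < expo v i ord0)%N) \/ v = consm zero_exp (pullm (OIshift n) v).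
Proof.
have [|v0] := EM (exists i, (0 < expo v i ord0)%N); [by left|right].
apply: expoP => i j; case: (unliftP ord0 j) => [k ->|->].
  by rewrite consmS pullE OIshiftE.
rewrite consm0; apply/eqP; rewrite -leqn0 leqNgt; apply/negP => vi.
by case: v0; exists i.
Qed.

Lemma mpolyX_var (v : mon c n.+1) i : (0 < expo v i ord0)%N ->
  'X_[v] = OIvar K i ord0 * 'X_[v - U_(enum_rank (i, ord0))].
Proof.
move=> vi; rewrite /OIvar -mpolyXD addmC submK // lep1mP -lt0n.
exact: vi.
Qed.

Lemma unshiftX_shift (u : mon c n) : unshift 'X_[pushm (OIshift n) u] = 'X_[u].
Proof.
rewrite -OIPmapX.
have idX : comp_mpoly [tuple 'X_i | i < #|{: 'I_c * 'I_n}|] 'X_[u] = 'X_[K, u].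
  exact: comp_mpoly_id.
rewrite -[RHS]idX /OIPmap !comp_mpolyX (rmorph_prod unshift); apply: eq_bigr => k _.
rewrite (rmorphXn unshift) /= !tnth_mktuple OIshiftE unshift_varS /OIvar.
by rewrite -surjective_pairing enum_valK.
Qed.

Lemma coef_unshift (p : OIP K c n.+1) (u : mon c n) :
  (unshift p : {mpoly K[_]})@_u = (p : {mpoly K[_]})@_(consm zero_exp u).
Proof.
rewrite [in LHS](mpolyE p) [in RHS](mpolyE p).
rewrite unshift_sum !raddf_sum; apply: eq_bigr => v _ /=.
rewrite /unshift linearZ /= -/unshift !mcoeffZ; congr (_ * _).
case: (consm_zeroP v) => [[i vi]|vE]; last first.
  rewrite vE {1}consm_zero unshiftX_shift !mcoeffX; congr ((nat_of_bool _)%:R).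
  apply/eqP/eqP => [->//|]; move/(congr1 (pullm (OIshift n))).
  by rewrite !pull_consm.
have -> : unshift 'X_[v] = 0 by rewrite (mpolyX_var vi) unshiftM unshift_var mul0r.
rewrite mcoeff0 mcoeffX.
case: eqP => // vE; move: vi; rewrite vE consm0 //.
Qed.

Lemma shiftK : cancel (OIPmap (K := K) (OIshift n)) unshift.
Proof.
move=> p; rewrite [p in LHS](mpolyE p) [RHS](mpolyE p).
rewrite (raddf_sum (OIPmap (OIshift n))) unshift_sum; apply: eq_bigr => v _ /=.
rewrite /OIPmap /unshift !linearZ /= -/unshift -/(OIPmap _ _) OIPmapX.
by rewrite unshiftX_shift.
Qed.

Lemma unshift_homog k (p : OIP K c n.+1) :
  (p : {mpoly K[_]}) \is k.-homog -> (unshift p : {mpoly K[_]}) \is k.-homog.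
Proof.
move=> /dhomogP pk; apply/dhomogP => u.
rewrite mcoeff_msupp coef_unshift -mcoeff_msupp => /pk <-.
by rewrite /= mdeg_consm big1.
Qed.

Lemma shift_homog k (p : OIP K c n) : (p : {mpoly K[_]}) \is k.-homog ->
  (OIPmap (OIshift n) p : {mpoly K[_]}) \is k.-homog.
Proof.
move=> /dhomogP pk; rewrite (mpolyE p) (raddf_sum (OIPmap (OIshift n))) /=.
rewrite big_seq; apply: rpred_sum => u /pk uk.
rewrite /OIPmap linearZ /= -/(OIPmap _ _) OIPmapX; apply: dhomogZ.
by rewrite dhomogX /= mdeg_push uk.
Qed.

End Unshift.

Section Projection.
Variables (K : fieldType) (c d n : nat) (d' : option nat).
Variable j : OIbasis d' n -> OIbasis (Some d) n.+1.

(** The part of [q] carried by the basis elements of one kind, modulo [x_1]. *)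
Definition proj (q : OIfree K c (Some d) n.+1) : OIfree K c d' n :=
  [ffun b => unshift (q (j b))].

Lemma projD : {morph proj : x y / x + y}.
Proof.
by move=> x y; apply/ffunP => b; rewrite !ffunE unshiftD.
Qed.

Lemma projZ a q : proj (a *: q) = unshift a *: proj q.
Proof.
by apply/ffunP => b; rewrite !ffunE; apply: unshiftM.
Qed.

Lemma coef_proj q u b :
  coef (proj q) u b = coef q (consm (zero_exp (c:=c)) u) (j b).
Proof. by rewrite /coef ffunE coef_unshift. Qed.

Lemma proj_homog k q : free_deg k q -> free_deg k (proj q).
Proof. by move=> qk b; rewrite ffunE; apply: unshift_homog. Qed.

End Projection.

Section Lifting.
Variables (K : fieldType) (c d n : nat).

(** A section of the projections on both kinds of basis elements. *)
Definition lift_pair (q' : OIfree K c (OIpred d) n) (q'' : OIfree K c (Some d) n) :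
    OIfree K c (Some d) n.+1 :=
  [ffun r => OIPmap (OIshift n)
     (\sum_(b | OIbasis_ext b == r) (q' b : OIP K c n) +
      \sum_(b | OIbasis_shift b == r) (q'' b : OIP K c n))].

Lemma proj_ext_lift q' q'' : proj (@OIbasis_ext d n) (lift_pair q' q'') = q'.
Proof.
apply/ffunP => b; rewrite !ffunE shiftK (big_pred1 b) => [|a].
  rewrite [X in _ + X]big1 ?addr0 // => a /eqP/esym/eqP.
  by rewrite (negPf (OIbasis_ext_shift _ _)).
by rewrite /= (inj_eq (@OIbasis_ext_inj _ _)).
Qed.

Lemma proj_shift_lift q' q'' : proj (@OIbasis_shift d n) (lift_pair q' q'') = q''.
Proof.
apply/ffunP => b; rewrite !ffunE shiftK addrC (big_pred1 b) => [|a].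
  rewrite [X in _ + X]big1 ?addr0 // => a.
  by rewrite (negPf (OIbasis_ext_shift _ _)).
by rewrite /= (inj_eq (@OIbasis_shift_inj _ _)).
Qed.

Lemma lift_pair_homog k q' q'' :
  free_deg k q' -> free_deg k q'' -> free_deg k (lift_pair q' q'').
Proof.
move=> q'k q''k r; rewrite ffunE; apply: shift_homog.
by apply: rpredD; apply: rpred_sum => b _; [apply: q'k|apply: q''k].
Qed.

End Lifting.

Section Isomorphism.
Variables (K : fieldType) (c d m : nat) (M : OIsubmod K c (Some d)).
Hypothesis sM : forall n, spanned (M n).
Variables (e : 'I_c -> nat) (n : nat).

Lemma coef_xpowZ (q : OIfree K c (Some d) n.+1) u b :
  coef (xpow K n e *: q) (consm e u) b = coef q (consm (zero_exp (c:=c)) u) b.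
Proof.
rewrite /coef ffunE xpowE [consm e u]consm_push consm_zero.
rewrite [X in X@__]mulrC.
exact: (mcoeffMX (q b : {mpoly K[#|{: 'I_c * 'I_n.+1}|]})).
Qed.

Lemma xpow_OImon u (b : OIbasis (Some d) n.+1) :
  xpow K n e *: OImon K (consm (zero_exp (c:=c)) u) b = OImon K (consm e u) b.
Proof. by rewrite xpowE scale_OImon [consm e u]consm_push consm_zero. Qed.

Lemma OImon_var (v : mon c n.+1) i (r : OIbasis (Some d) n.+1) :
  (0 < expo v i ord0)%N -> exists w, OImon K v r = OIvar K i ord0 *: w.
Proof.
move=> vi; exists (OImon K (v - U_(enum_rank (i, ord0)))%MM r).
apply/ffunP => b; rewrite !ffunE; case: eqP => _; last exact/esym/mulr0.
exact: mpolyX_var.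
Qed.

(** A monomial that involves the first column lies in [x_1 F]. For the other ones,
    both sides say that the product with [x_1^e] lies in [M]. *)
Lemma mem_colon_plus (q : OIfree K c (Some d) n.+1) : (m <= n)%N ->
  q \in colon_plus M e n <->
  proj (@OIbasis_ext d n) q \in colon_ext M e n /\
  proj (@OIbasis_shift d n) q \in colon_shift m M e n.
Proof.
move=> mn; split.
  move=> /asboolP[x [y [xM /asboolP[w yE] ->]]].
  have y0 d' (j : OIbasis d' n -> OIbasis (Some d) n.+1) : proj j y = 0.
    apply/ffunP => b; rewrite !ffunE yE sum_ffunE unshift_sum.
    rewrite big1 // => i _; rewrite ffunE [X in unshift X]/(_ * _).
    by rewrite unshiftM unshift_var mul0r.
  rewrite !projD !y0 !addr0.
  split; apply: mem_coef => u b; rewrite coef_proj -coef_xpowZ => /(sM xM) uM;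
    by apply/mem_colon_module.
move=> [q'Q q''Q]; apply: mem_coef => v r.
case: (consm_zeroP v) => [[i vi] _|->].
  have [w ->] := OImon_var r vi.
  apply/asboolP; exists 0, (OIvar K i ord0 *: w); rewrite rpred0 add0r; split=> //.
  apply/asboolP; exists (fun k => if k == i then w else 0).
  by rewrite (bigD1 i) //= eqxx big1 ?addr0 // => k /negPf->; rewrite scaler0.
set u := pullm _ v => qv.
have uM : OImon K (consm e u) r \in M n.+1.
  case: (OIbasisP r) qv => b; rewrite -coef_proj.
    by move=> /(spanned_colon_module q'Q)/mem_colon_module[].
  by move=> /(spanned_colon_module q''Q)/mem_colon_module[].
apply/asboolP; exists (OImon K (consm (zero_exp (c:=c)) u) r), 0.
by rewrite rpred0 addr0; split=> //; rewrite -xpow_OImon in uM.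
Qed.

Lemma colon_plus_iso : (m <= n)%N ->
  graded_iso
    (quot_deg (N := colon_plus M e n) :
       nat -> set (restr (OIPmap (OIshift n)) (modquot (colon_plus M e n))))
    (sum_deg (N := colon_ext M e n) (N' := colon_shift m M e n)).
Proof.
move=> mn.
pose h q := (modquot_pi (colon_ext M e n) (proj (@OIbasis_ext d n) q),
             modquot_pi (colon_shift m M e n) (proj (@OIbasis_shift d n) q)).
have h_lift q' q'' : h (lift_pair q' q'') = (modquot_pi _ q', modquot_pi _ q'').
  by rewrite /h proj_ext_lift proj_shift_lift.
have [||||phi [phi_bij phiE]] := @first_isomorphism _ _ (OIPmap (OIshift n))
  _ (colon_plus M e n) _ h.
- by move=> x y; rewrite /h !projD !modquot_piD.
- by move=> a v; rewrite /h !projZ shiftK !modquot_piZ.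
- move=> v; rewrite mem_colon_plus // -!modquot_pi_eq0.
  by split=> [[-> ->]|[v' v'']] //; rewrite /h v' v''.
- move=> [x y].
  exists (lift_pair (repr (x : Quotient.quot _)) (repr (y : Quotient.quot _))).
  by rewrite h_lift !modquot_reprK.
exists phi; split=> // k v; split=> [[q [qk ->]]|].
  rewrite phiE; split; eexists; split=> //; exact: proj_homog.
move=> [[q' [q'k vq']] [q'' [q''k vq'']]].
exists (lift_pair q' q''); split; first exact: lift_pair_homog.
apply: (bij_inj phi_bij); rewrite phiE h_lift -vq' -vq''.
exact: surjective_pairing.
Qed.

End Isomorphism.

Theorem proposition4p1 (K : fieldType) (c : nat) (hc : (1 <= c)%N) (d m : nat)
    (M : OIsubmod K c (Some d)) (hM : OImonomial M)
    (hm : generated_in_width M m%:Z) (e : 'I_c -> nat) :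
  exists (Q' : OIsubmod K c (OIpred d)) (Q'' : OIsubmod K c (Some d)),
    [/\ OImonomial Q' /\ generated_in_width Q' (m%:Z - 1),
        OImonomial Q'' /\ generated_in_width Q'' m%:Z,
        forall n, n%:Z = m%:Z - 1 ->
          forall q : OIfree K c (Some d) n, q \in Q'' n -> q = 0,
        (* the width n of the source is [n.+1] here *)
        forall n, (m + 1 <= n.+1)%N ->
          graded_iso
            (quot_deg (N := colon_plus M e n) :
               nat -> set (restr (OIPmap (OIshift n))
                                 (modquot (colon_plus M e n))))
            (sum_deg (N := Q' n) (N' := Q'' n))
      & (hilb_sum (Q'' m) <= hilb_sum (M m))%N /\
        (hilb_sum (M m) = hilb_sum (Q'' m) <->
         forall n, (m <= n)%N -> M n =i Q'' n)].
Proof.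
have sM := OImonomial_spanned hM.
have Mgen n (u : 'X_{1..#|{: 'I_c * 'I_n}|}) b : OImon K u b \in M n ->
    exists k (v : 'X_{1..#|{: 'I_c * 'I_k}|}) a,
      [/\ (k <= m)%N, OImon K v a \in M k & mdvd v a u b].
  by move=> /(generated_mdvd hM hm).
have sQ := spanned_colon_module.
exists (colon_ext M e), (colon_shift m M e).
have monQ'' : OImonomial (colon_shift m M e) by apply/spanned_OImonomial/sQ.
have genQ'' : generated_in_width (colon_shift m M e) m%:Z.
  exact: colon_shift_generated.
have [sum_le sum_eq] := hilb_sum_le (sM m) (sQ _ _ _ _ _ _ _ _ _ _)
  (sub_colon_shift sM e) (colon_shift_min_mon (e := e) Mgen).
split=> //.
- by split; [apply/spanned_OImonomial/sQ|apply: colon_ext_generated].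
- by move=> n nm q; apply: colon_shift_eq0; lia.
- by move=> n mn; apply: colon_plus_iso => //; rewrite addn1 in mn.
split=> //; rewrite sum_eq; split=> [MQ n|MQ]; last exact: MQ.
by apply: eq_from_width MQ => // k; apply: sQ.
Qed.
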